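(* Let $\omega:[1,\infty)\to(0,\infty)$ be a positive monotonically decreasing (i.e. non-increasing) function with $$\sum_{j=1}^{\infty} j\,\omega\left(\sqrt{j}\right)<+\infty .$$ Then for almost every $2$-dimensional linear subspace $A\subset\mathbb{R}^4$ there exists a constant $C(A)>0$ such that $$\psi(A,B)\ge C(A)\,\omega(H(B))\quad\text{for all } 2\text{-dimensional rational subspaces } B \text{ of } \mathbb{R}^4 .$$ In particular, for every $\varepsilon>0$, for almost every $2$-dimensional linear subspace $A\subset\mathbb{R}^4$ there exists a constant $C(A,\varepsilon)>0$ such that $$\psi(A,B)\ge C(A,\varepsilon)\,(H(B))^{-4-\varepsilon}\quad\text{for all } 2\text{-dimensional rational subspaces } B \text{ of } \mathbb{R}^4 .$$
   Context: $\mathbb{R}^4$ has coordinates $(z_1,z_2,z_3,z_4)$, the standard inner product $\langle\cdot,\cdot\rangle$ and Euclidean norm $|\cdot|$. Rational subspaces and height: for a linear subspace $L\subset\mathbb{R}^4$ put $\Gamma_L=L\cap\mathbb{Z}^4$. $L$ is called rational if the rank of the lattice $\Gamma_L$ equals $\dim L$. For a rational $L$, the height $H(L)$ is the discriminant (covolume in $L$, with respect to the induced Euclidean structure) of the lattice $\Gamma_L$; thus $H(L)\ge 1$ and $H(L)^2\in\mathbb{Z}$. Angle: for nonzero vectors $w,z$, $\sigma(w,z)\in[0,\pi]$ is the angle between them, $\cos\sigma(w,z)=\langle w,z\rangle/(|w||z|)$. For linear subspaces $L_1,L_2$, $\psi(L_1,L_2)=\min \sigma(w,z)$, the minimum taken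 over unit vectors $w\in L_1$, $z\in L_2$. ''Almost every'': let $\mathcal{E}$ be the set of $\ell=(\ell_{1,1},\ell_{1,2},\ell_{2,1},\ell_{2,2})\in[-1,1]^4$ with $|\ell_{1,1}\ell_{2,2}-\ell_{2,1}\ell_{1,2}|\le 1$. For each pair $1\le i_1<i_2\le 4$ let $i_3<i_4$ be the two remaining indices, and for $\ell\in\mathcal{E}$ let $$L_{i_1,i_2}(\ell)=\{z\in\mathbb{R}^4: z_{i_3}=\ell_{1,1}z_{i_1}+\ell_{1,2}z_{i_2},\ z_{i_4}=\ell_{2,1}z_{i_1}+\ell_{2,2}z_{i_2}\}.$$ Every $2$-dimensional subspace of $\mathbb{R}^4$ has the form $L_{i_1,i_2}(\ell)$ for some $i_1<i_2$ and $\ell\in\mathcal{E}$. A property holds for almost every $2$-dimensional subspace if, $\mathfrak{A}$ denoting the set of $2$-dimensional subspaces for which it fails, the set $\{\ell\in\mathcal{E}: L_{i_1,i_2}(\ell)\in\mathfrak{A}\}$ has $4$-dimensional Lebesgue measure $0$ for every pair $i_1<i_2$. *)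

(* Defs.v *)
From HB Require Import structures.
From mathcomp Require Import all_boot all_order all_algebra.
From mathcomp Require Import all_classical all_reals all_analysis.
From mathcomp Require Import ring.

Set Implicit Arguments.
Unset Strict Implicit.
Unset Printing Implicit Defensive.

Import Order.TTheory GRing.Theory Num.Theory.

Local Open Scope classical_set_scope.
Local Open Scope ring_scope.

Section Euclidean.
Variables (R : realType) (n : nat).
Implicit Types (w z : 'rV[R]_n) (L : {vspace 'rV[R]_n}).

Definition dotp w z : R := (w *m z^T) 0 0.

Definition enorm z : R := Num.sqrt (dotp z z).

Definition angle w z : R := acos (dotp w z / (enorm w * enorm z)).

(* The infimum is a minimum (compactness of unit spheres) as soon as both
   subspaces are nonzero. *)
Definition psi L1 L2 : R :=
  inf [set s | exists w z, [/\ w \in L1, z \in L2, enorm w = 1, enorm z = 1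
                             & s = angle w z]].

Definition int_points L : set 'rV[R]_n :=
  [set z | z \in L /\ z \is a mxOver Num.int].

(* The rows of B are a Z-basis of the subgroup G: they belong to G, and every
   element of G is in a unique way an integer combination of them. *)
Definition zbasis (G : set 'rV[R]_n) (k : nat) (B : 'M[R]_(k, n)) : Prop :=
  (forall i, G (row i B)) /\
  (forall z, G z -> exists! c : 'rV[int]_k, z = map_mx intr c *m B).

(* A free abelian group has rank k iff it has a Z-basis with k elements. *)
Definition rational_subspace L : Prop :=
  exists B : 'M[R]_(\dim L, n), zbasis (int_points L) B.

(* The covolume is the square root of the Gram determinant of a Z-basis; it does
   not depend on the basis, see heightE. *)
Definition height L : R :=
  xget 0 [set h | exists2 B : 'M[R]_(\dim L, n),
            zbasis (int_points L) B & h = Num.sqrt (\det (B *m B^T))].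

Lemma zbasis_gram (G : set 'rV[R]_n) (k : nat) (B B' : 'M[R]_(k, n)) :
  zbasis G B -> zbasis G B' -> \det (B *m B^T) = \det (B' *m B'^T).
Proof.
have change (D D' : 'M[R]_(k, n)) : zbasis G D -> zbasis G D' ->
    exists U : 'M[int]_k, D = map_mx intr U *m D'.
  move=> [GD _] [_ /(_ _ (GD _)) bD'].
  have /choice[c cP] i : exists c : 'rV[int]_k, row i D = map_mx intr c *m D'.
    by have [c [-> _]] := bD' i; exists c.
  exists (\matrix_i c i); apply/row_matrixP => i.
  by rewrite cP row_mul -map_row rowK.
move=> bB bB'; have [U BE] := change _ _ bB bB'.
have [V B'E] := change _ _ bB' bB.
have UV1 : U *m V = 1%:M.
  apply/row_matrixP => i; have [GB uB] := bB.
  have [c [_ cU]] := uB _ (GB i).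
  transitivity c.
    by apply/esym/cU; rewrite map_row -row_mul map_mxM -mulmxA -B'E -BE.
  by apply: cU; rewrite map_row map_mx1 -row_mul mul1mx.
have detU : (\det U)%:~R ^+ 2 = 1 :> R.
  have : \det U \is a GRing.unit.
    by rewrite -unitmxE; have [] := mulmx1_unit UV1.
  by move=> /orP[] /eqP ->; rewrite ?mulrN1z ?sqrrN expr1n.
rewrite BE trmx_mul mulmxA -(mulmxA _ B') !det_mulmx det_tr det_map_mx.
by rewrite mulrAC -expr2 detU mul1r.
Qed.

Lemma heightE L (B : 'M[R]_(\dim L, n)) :
  zbasis (int_points L) B -> height L = Num.sqrt (\det (B *m B^T)).
Proof.
move=> bB; rewrite /height; case: xgetP => [h _ [B' bB' ->]|].
  by rewrite (zbasis_gram bB' bB).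
by move=> /(_ (Num.sqrt (\det (B *m B^T)))) []; exists B.
Qed.

End Euclidean.

Section AlmostEveryPlane.
Variable R : realType.

(* The parameters (l11, l12, l21, l22), nested to the left to match the iterated
   product of measures below. *)
Definition params : Type :=
  (measurableTypeR R * measurableTypeR R * measurableTypeR R
     * measurableTypeR R)%type.

Definition lebesgue4 : set params -> \bar R :=
  (lebesgue_measure \x lebesgue_measure \x lebesgue_measure
     \x lebesgue_measure)%E.

Definition param_dom : set params :=
  [set l | let: (l11, l12, l21, l22) := l in
     [/\ l11 \in `[-1, 1], l12 \in `[-1, 1], l21 \in `[-1, 1], l22 \in `[-1, 1]
       & `|l11 * l22 - l21 * l12| <= 1]].

Definition plane_eqs (i1 i2 i3 i4 : 'I_4) (l : params) (z : 'rV[R]_4) : R * R :=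
  let: (l11, l12, l21, l22) := l in
  (z 0 i3 - (l11 * z 0 i1 + l12 * z 0 i2),
   z 0 i4 - (l21 * z 0 i1 + l22 * z 0 i2)).

Definition plane (i1 i2 i3 i4 : 'I_4) (l : params) : {vspace 'rV[R]_4} :=
  lker (linfun (plane_eqs i1 i2 i3 i4 l : 'rV[R]_4 -> R^o * R^o)).

Lemma mem_plane i1 i2 i3 i4 (l11 l12 l21 l22 : R) (z : 'rV[R]_4) :
  z \in plane i1 i2 i3 i4 (l11, l12, l21, l22) <->
  z 0 i3 = l11 * z 0 i1 + l12 * z 0 i2 /\
  z 0 i4 = l21 * z 0 i1 + l22 * z 0 i2.
Proof.
pose f : 'rV[R]_4 -> R^o * R^o := plane_eqs i1 i2 i3 i4 (l11, l12, l21, l22).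
have f_lin : linear f.
  move=> a u v; congr pair; rewrite !mxE /= /GRing.scale /=; ring.
pose m := GRing.isLinear.Build _ _ _ _ f f_lin.
pose F : {linear 'rV[R]_4 -> (R^o * R^o)%type} := HB.pack f m.
have fE : linfun f z = f z by exact: (lfunE F z).
rewrite /plane memv_ker fE /f /=; split.
  by move=> /eqP[/subr0_eq -> /subr0_eq ->].
by move=> [-> ->]; rewrite !subrr.
Qed.

(* i3 < i4 range over the complement of the pair i1 < i2; negligible means
   contained in a Borel set of measure 0, i.e., of Lebesgue measure 0. *)
Definition ae_plane (P : {vspace 'rV[R]_4} -> Prop) : Prop :=
  forall i1 i2 i3 i4 : 'I_4,
    (i1 < i2)%N -> (i3 < i4)%N -> uniq [:: i1; i2; i3; i4] ->
    negligible lebesgue4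
      [set l | param_dom l /\
         [set A | \dim A = 2%N /\ ~ P A] (plane i1 i2 i3 i4 l)].

End AlmostEveryPlane.

(* Main.v *)
From HB Require Import structures.
Require Import Defs.
From mathcomp Require Import all_boot all_order all_algebra.
From mathcomp Require Import all_classical all_reals all_analysis.
From mathcomp Require Import measurable_realfun.
From mathcomp Require Import ring lra zify.
Import Order.TTheory GRing.Theory Num.Theory numFieldNormedType.Exports.
Local Open Scope classical_set_scope.
Local Open Scope ring_scope.

Set Implicit Arguments.
Unset Strict Implicit.
Unset Printing Implicit Defensive.

(* A rational plane B of height H has a basis of integral vectors u, v with
   |u|^2 |v|^2 - <u, v>^2 = H^2, and a minimal such basis is reduced:
   2 |<u, v>| <= |u|^2 <= |v|^2.  Counting reduced pairs, there are O(X^4) planes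
   of height at most X.  In a chart with parameters l, the determinant F(l) of a
   basis of A = A(l) and of u, v is a polynomial c0 + (linear) + c5 det l whose
   coefficients are, up to sign, the Pluecker coordinates of B, so its coefficient
   vector has norm H; and |F(l)| <= 3 H psi(A, B).  Slicing along the parameter in
   which the derivative of F is largest shows that {|F| <= s H} has measure O(s),
   uniformly in B.  Hence the parameters l for which psi(A, B) < omega(H(B)) / n
   for some B have measure at most a constant times
   (1 / n) \sum_k 16^k omega(2^k), a sum which is controlled by the given series
   by condensation; the exceptional parameters are those with this property for
   all n. *)

(** * Product measures *)

Section SigmaFiniteProduct.
Context {d1 d2 : measure_display} {T1 : measurableType d1}
  {T2 : measurableType d2} {R : realType}.
Variables (m1 : {sigma_finite_measure set T1 -> \bar R})
  (m2 : {sigma_finite_measure set T2 -> \bar R}).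

(* An alias of [m1 \x m2]: the canonical sigma-finite structure of the latter
   is keyed on probability measures, so it does not apply to Lebesgue measure. *)
Definition prod_measure := (m1 \x m2)%E.

HB.instance Definition _ := Measure.on prod_measure.

Lemma prod_measure_sigma_finite : sigma_finite setT prod_measure.
Proof.
have [F TF Foo] := sigma_finiteT m1; have [G TG Goo] := sigma_finiteT m2.
(* Codes that are not codes of pairs repeat the rectangle of [(0, 0)], which is harmless in a
   cover. *)
pose A n := F (odflt (0, 0)%N (unpickle n : option (nat * nat))).1.
pose B n := G (odflt (0, 0)%N (unpickle n : option (nat * nat))).2.
exists (fun n => A n `*` B n); last first.
  move=> n; have [mA Aoo] : measurable (A n) /\ (m1 (A n) < +oo)%E by exact: Foo.
  have [mB Boo] : measurable (B n) /\ (m2 (B n) < +oo)%E by exact: Goo.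
  split; first exact: measurableX.
  by rewrite /prod_measure product_measure1E// lte_mul_pinfty// ge0_fin_numE.
apply/esym; rewrite -subTset => -[x y] _.
have [i _ Fx] : (\bigcup_i F i) x by rewrite -TF.
have [j _ Gy] : (\bigcup_i G i) y by rewrite -TG.
by exists (pickle (i, j)) => //; rewrite /A /B pickleK; split.
Qed.

HB.instance Definition _ := Measure_isSigmaFinite.Build _ _ _ prod_measure
  prod_measure_sigma_finite.

End SigmaFiniteProduct.

Section ProductMeasure.
Context {d1 d2 : measure_display} {T1 : measurableType d1}
  {T2 : measurableType d2} {R : realType}.
Variables (m1 : {sigma_finite_measure set T1 -> \bar R})
  (m2 : {sigma_finite_measure set T2 -> \bar R}).

(** The two orders of integration give the same values on rectangles, and these values determine the
    product measure. *)
Lemma product_measure1_2E (S : set (T1 * T2)) : measurable S ->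
  prod_measure m1 m2 S = (\int[m2]_y m1 (ysection S y))%E.
Proof.
move=> mS; transitivity ((m1 \x^ m2)%E S); last by [].
by apply: product_measure_unique => // A B mA mB; exact: product_measure2E.
Qed.

Lemma product_measure_le_ysection (S : set (T1 * T2)) (D : set T2) (K : R) :
  measurable S -> measurable D -> 0 <= K ->
  (forall y, (m1 (ysection S y) <= K%:E * (\1_D y)%:E)%E) ->
  (prod_measure m1 m2 S <= K%:E * m2 D)%E.
Proof.
move=> mS mD K0 SK; rewrite product_measure1_2E//.
have m1D : measurable_fun setT (fun y => (\1_D y)%:E : \bar R).
  by apply/measurable_EFinP; exact: measurable_indic.
rewrite -(setIT D) -integral_indic// -ge0_integralZl//=.
apply: ge0_le_integral => //=.
- exact: measurable_fun_ysection.
- exact: emeasurable_funM.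
Qed.

Lemma product_measure_swap (S : set (T1 * T2)) : measurable S ->
  prod_measure m2 m1 ((fun p => (p.2, p.1)) @^-1` S) = prod_measure m1 m2 S.
Proof.
move=> mS; rewrite product_measure1_2E//; exact: eq_integral.
Qed.

Lemma product_measure_preserve (phi : T1 -> T1) : measurable_fun setT phi ->
  (forall A, measurable A -> m1 (phi @^-1` A) = m1 A) ->
  forall S : set (T1 * T2), measurable S ->
  prod_measure m1 m2 ((fun p => (phi p.1, p.2)) @^-1` S) = prod_measure m1 m2 S.
Proof.
move=> mphi phiE S mS.
have mPhi : measurable_fun setT (fun p : T1 * T2 => (phi p.1, p.2)).
  by apply/measurable_fun_pair => //=; exact: measurableT_comp.
rewrite !product_measure1_2E//; last by rewrite -[_ @^-1` _]setTI; exact: mPhi.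
apply: eq_integral => y _ /=; rewrite -[RHS]phiE; last exact: measurable_ysection.
by congr (m1 _); apply/seteqP; split=> x; rewrite /ysection /= !inE.
Qed.

End ProductMeasure.

(** By Tonelli the triple product integrates, over the first factor, the [m2 \x m2] measure of the
    slices; on each slice [product_measure_swap] applies. *)
Lemma product_measure_swapr {d1 d2 : measure_display} {T1 : measurableType d1}
    {T2 : measurableType d2} {R : realType}
    (m1 : {sigma_finite_measure set T1 -> \bar R})
    (m2 : {sigma_finite_measure set T2 -> \bar R}) (S : set (T1 * T2 * T2)) :
  measurable S ->
  prod_measure (prod_measure m1 m2) m2 ((fun p => (p.1.1, p.2, p.1.2)) @^-1` S)
    = prod_measure (prod_measure m1 m2) m2 S.
Proof.
have nested (A : set (T1 * T2 * T2)) : measurable A ->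
    prod_measure (prod_measure m1 m2) m2 A =
    (\int[m1]_x prod_measure m2 m2 [set p | A (x, p.1, p.2)])%E.
  move=> mA; rewrite [LHS](@fubini_tonelli1 _ _ _ _ _ _ _ (m2 \o xsection A))//.
  exact: measurable_fun_xsection.
move=> mS.
have mf : measurable_fun setT (fun p : T1 * T2 * T2 => (p.1.1, p.2, p.1.2)).
  apply/measurable_fun_pair => //=; last exact: measurableT_comp.
  by apply/measurable_fun_pair => //=; exact: measurableT_comp.
have mfS := mf measurableT _ mS; rewrite setTI in mfS.
rewrite (nested _ mS) (nested _ mfS).
apply: eq_integral => x _; rewrite -[RHS]product_measure_swap//.
have mx : measurable_fun setT (fun p : T2 * T2 => (x, p.1, p.2)).
  by apply/measurable_fun_pair => //=; apply/measurable_fun_pair.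
by rewrite -[X in measurable X]setTI; exact: mx.
Qed.

(** * Measure of a set from its iterated slices *)

Section Slices.
Context {R : realType}.
Local Notation lam := (@lebesgue_measure R).

Lemma lebesgue_measure_segment (p k : R) : 0 <= k ->
  lebesgue_measure `[p, p + k] = k%:E.
Proof.
move=> k0; rewrite lebesgue_measure_itv/= lte_fin; case: ltP => pk.
  by rewrite -EFinB; congr EFin; ring.
by congr EFin; lra.
Qed.

Lemma lebesgue4E : lebesgue4 (R:=R)
  = prod_measure (prod_measure (prod_measure lam lam) lam) lam.
Proof. by []. Qed.

(** The sides [k], [a], [b] may depend on [w]; only their product is bounded uniformly. This admits
    slices that are long in [x] while thin in [y] and [z]. The factor [2] is the length of the range
    of [w]. *)
Lemma lebesgue4_le_slices (S : set (params R)) (K : R) : measurable S ->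
  (forall w, exists k a b py pz : R,
     [/\ 0 <= k, 0 <= a, 0 <= b, k * a * b <= K &
       (forall x y z, S (x, y, z, w) ->
         [/\ -1 <= w <= 1, py <= y <= py + a & pz <= z <= pz + b]) /\
       (forall y z, exists px, forall x, S (x, y, z, w) ->
         px <= x <= px + k)]) ->
  (lebesgue4 S <= (2 * K)%:E)%E.
Proof.
move=> mS SK.
have K0 : 0 <= K.
  have [k [a [b [_ [_ [k0 a0 b0 kK _]]]]]] := SK 0.
  by rewrite (le_trans _ kK)// !mulr_ge0.
rewrite mulrC EFinM lebesgue4E -(@lebesgue_measure_segment (-1) 2)//.
apply: product_measure_le_ysection => // w.
have [k [a [b [py [pz [k0 a0 b0 kK [SI Sx]]]]]]] := SK w.
rewrite indicE; case: (boolP (w \in _)) => wI; last first.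
  rewrite mule0 (_ : ysection S w = set0) ?measure0//.
  apply/seteqP; split => // -[[x y] z] /ysectionP/SI[w1 _ _].
  by case/negP: wI; rewrite inE /= in_itv /=; lra.
rewrite mule1; apply: le_trans (_ : ((k * a)%:E * b%:E <= _)%E); last first.
  by rewrite -EFinM lee_fin.
rewrite -(lebesgue_measure_segment pz b0).
have mSw : measurable (ysection S w) by exact: measurable_ysection.
apply: product_measure_le_ysection => //; first exact: mulr_ge0.
move=> z; rewrite indicE; case: (boolP (z \in _)) => zI; last first.
  rewrite mule0 (_ : ysection _ z = set0) ?measure0//.
  apply/seteqP; split => // -[x y] /ysectionP/ysectionP/SI[_ _ z1].
  by case/negP: zI; rewrite inE /= in_itv.
rewrite mule1 EFinM -(lebesgue_measure_segment py a0).
have mSwz : measurable (ysection (ysection S w) z).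
  exact: measurable_ysection.
apply: product_measure_le_ysection => // y.
rewrite indicE; case: (boolP (y \in _)) => yI; last first.
  rewrite mule0 (_ : ysection _ y = set0) ?measure0//.
  apply/seteqP; split => // x /ysectionP/ysectionP/ysectionP/SI[_ y1 _].
  by case/negP: yI; rewrite inE /= in_itv.
rewrite mule1; have [px Spx] := Sx y z.
rewrite -(lebesgue_measure_segment px k0); apply: le_measure.
- by rewrite inE; exact: measurable_ysection.
- by rewrite inE; exact: measurable_itv.
- by move=> x /ysectionP/ysectionP/ysectionP/Spx; rewrite /= in_itv.
Qed.

End Slices.

(** * Measure of the neighborhoods of a Schubert variety *)

Section Schubert.
Context {R : realType}.
Implicit Types (c s w x y z : R) (l : params R).

(** When the coefficients are the suitably signed Pluecker coordinates of a plane, the zeros are the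
    planes of the chart meeting it nontrivially, a Schubert variety. *)
Definition schubert (c0 c1 c2 c3 c4 c5 : R) (l : params R) : R :=
  c0 + c1 * l.1.1.1 + c2 * l.1.1.2 + c3 * l.1.2 + c4 * l.2
  + c5 * (l.1.1.1 * l.2 - l.1.2 * l.1.1.2).

Definition cube : set (params R) :=
  [set l | `|l.1.1.1| <= 1] `&` [set l | `|l.1.1.2| <= 1]
  `&` [set l | `|l.1.2| <= 1] `&` [set l | `|l.2| <= 1].

Definition schubert_nbhd (c0 c1 c2 c3 c4 c5 s : R) : set (params R) :=
  cube `&` [set l | `|schubert c0 c1 c2 c3 c4 c5 l| <= s].

(* The part of the neighborhood where the partial derivative in the first
   parameter dominates those in the second and the third. *)
Definition schubert_pivot (c0 c1 c2 c3 c4 c5 s : R) : set (params R) :=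
  schubert_nbhd c0 c1 c2 c3 c4 c5 s
  `&` [set l | `|c2 - c5 * l.1.2| <= `|c1 + c5 * l.2| ]
  `&` [set l | `|c3 - c5 * l.1.1.2| <= `|c1 + c5 * l.2| ].

Lemma measurable_set_le d (T : measurableType d) (f g : T -> R) :
  measurable_fun setT f -> measurable_fun setT g ->
  measurable [set t | f t <= g t].
Proof.
move=> mf mg.
have := measurable_fun_ler mf mg measurableT (Y := [set true]) I.
by rewrite setTI.
Qed.

Lemma measurable_params :
  [/\ measurable_fun setT (fun l => l.1.1.1 : R),
      measurable_fun setT (fun l => l.1.1.2 : R),
      measurable_fun setT (fun l => l.1.2 : R) &
      measurable_fun setT (fun l => l.2 : R)].
Proof.
have m1 : measurable_fun setT (fun l => l.1) by exact: measurable_fst.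
have m2 : measurable_fun setT (fun l => l.1.1) by exact: measurableT_comp.
split; first by exact: (measurableT_comp measurable_fst m2).
- by exact: (measurableT_comp measurable_snd m2).
- by exact: (measurableT_comp measurable_snd m1).
- by exact: measurable_snd.
Qed.

Lemma measurable_schubert_nbhd c0 c1 c2 c3 c4 c5 s :
  measurable (schubert_nbhd c0 c1 c2 c3 c4 c5 s).
Proof.
have [mx my mz mw] := measurable_params.
have mcst c (f : params R -> R) : measurable_fun setT f ->
    measurable_fun setT (fun l => c * f l).
  by move=> mf; apply: measurable_funM => //; exact: measurable_cst.
have mnorm (f : params R -> R) c : measurable_fun setT f ->
    measurable [set l | `|f l| <= c].
  move=> mf; apply: measurable_set_le; last exact: measurable_cst.
  exact: (measurableT_comp (@normr_measurable R setT)).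
apply: measurableI; first by do ?[apply: measurableI]; exact: mnorm.
apply: mnorm; do ?[apply: measurable_funD]; try exact: mcst.
  exact: measurable_cst.
by apply: mcst; apply: measurable_funB; exact: measurable_funM.
Qed.

Lemma measurable_schubert_pivot c0 c1 c2 c3 c4 c5 s :
  measurable (schubert_pivot c0 c1 c2 c3 c4 c5 s).
Proof.
have [mx my mz mw] := measurable_params.
have maff c c' (f : params R -> R) : measurable_fun setT f ->
    measurable_fun setT (fun l => `|c + c' * f l|).
  move=> mf; apply: (measurableT_comp (@normr_measurable R setT)).
  apply: measurable_funD; first exact: measurable_cst.
  by apply: measurable_funM => //; exact: measurable_cst.
have maffN c c' (f : params R -> R) : measurable_fun setT f ->
    measurable_fun setT (fun l => `|c - c' * f l|).
  by move=> mf; under eq_fun do rewrite -mulNr; exact: maff.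
apply: measurableI; last exact: measurable_set_le (maffN _ _ _ _) (maff _ _ _ _).
apply: measurableI; first exact: measurable_schubert_nbhd.
exact: measurable_set_le (maffN _ _ _ _) (maff _ _ _ _).
Qed.

Lemma segment_of_norm_affine (al be s x : R) : be != 0 ->
  `|al + be * x| <= s ->
  - (al / be) - s / `|be| <= x <= - (al / be) - s / `|be| + 2 * (s / `|be|).
Proof.
move=> be0 xs.
have : `|x + al / be| <= s / `|be|.
  rewrite ler_pdivlMr ?normr_gt0// -normrM.
  by rewrite (_ : _ * be = al + be * x)//; field.
by rewrite ler_norml => /andP[h1 h2]; apply/andP; split; lra.
Qed.

(** For fixed [w] the polynomial is affine in [x] with slope [g = c1 + c5 * w], so [x] lies in a
    segment of length [2 * s / |g|]. The pivot conditions confine [y] and [z] to segments of length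
    [2 * |g| / |c5|]. The product is [8 * s * |g| / |c5| ^ 2], which stays bounded by a multiple of
    [s] even for small slopes. *)
Lemma lebesgue4_schubert_pivot c0 c1 c2 c3 c4 c5 s : 0 <= s ->
  `|c1| <= 1 -> 1 / 20 <= `|c5| <= 1 ->
  (lebesgue4 (schubert_pivot c0 c1 c2 c3 c4 c5 s) <= (128 * (100 * s))%:E)%E.
Proof.
move=> s0 c11 /andP[c5l c5u].
have c5N0 : c5 != 0 by rewrite -normr_gt0; lra.
rewrite (_ : 128 * (100 * s) = 2 * (64 * (100 * s))); last by ring.
apply: lebesgue4_le_slices; first exact: measurable_schubert_pivot.
move=> w; have [w1|w1] := leP `|w : R| 1; last first.
  exists 0, 0, 0, 0, 0; split=> //; first by rewrite !mul0r; lra.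
  by split=> [x y z|y z]; last exists 0 => x; move=> [[[[_ /= h] _] _] _];
    rewrite leNgt w1 in h.
pose g : R := c1 + c5 * w.
have g2 : `|g| <= 2.
  rewrite (le_trans (ler_normD _ _))// normrM.
  rewrite (_ : 2 = 1 + 1 * 1); last by ring.
  by apply: lerD => //; apply: ler_pM.
pose r := `|g| / `|c5|.
have r0 : 0 <= r by rewrite divr_ge0.
(* For slope [0] the variable [x] fills [[-1, 1]], but then [r = 0] and the ranges of [y] and [z]
   are points. *)
pose k := if g == 0 then 2 else 2 * (s / `|g|).
have k0 : 0 <= k by rewrite /k; case: ifP => // _; rewrite mulr_ge0// divr_ge0.
exists k, (2 * r), (2 * r), (c3 / c5 - r), (c2 / c5 - r).
split=> //; try by rewrite mulr_ge0.
  rewrite /k; case: eqP => [g0|/eqP g0].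
    by rewrite /r g0 normr0 !mul0r !mulr0; lra.
  have -> : 2 * (s / `|g|) * (2 * r) * (2 * r) = 8 * s * `|g| / `|c5| ^+ 2.
    by rewrite /r; field; rewrite !normr_eq0 c5N0 g0.
  rewrite ler_pdivrMr; last by rewrite exprn_gt0//; lra.
  have : (1 / 20) ^+ 2 <= `|c5| ^+ 2 by rewrite lerXn2r ?nnegrE.
  move=> h.
  have : s * `|g| <= s * 2 by exact: ler_wpM2l.
  have : s * (1 / 20) ^+ 2 <= s * `|c5| ^+ 2 by exact: ler_wpM2l.
  lra.
split.
  move=> x y z [[[[_ /= _] _] hz] hy]; rewrite -/g in hz hy.
  split; first by rewrite -ler_norml.
    have := @segment_of_norm_affine c3 (- c5) `|g| y.
    rewrite oppr_eq0 mulNr => /(_ c5N0 hy).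
    rewrite normrN -/r invrN mulrN opprK; lra.
  have := @segment_of_norm_affine c2 (- c5) `|g| z.
  rewrite oppr_eq0 mulNr => /(_ c5N0 hz).
  rewrite normrN -/r invrN mulrN opprK; lra.
move=> y z; rewrite /k; case: eqP => [g0|/eqP g0].
  exists (-1) => x [[[[[[/= hx _] _] _] _] _] _].
  by move: hx; rewrite ler_norml; lra.
exists (- ((c0 + c2 * y + c3 * z + c4 * w - c5 * (z * y)) / g) - s / `|g|).
move=> x [[[_ /=]]]; rewrite /schubert /= => h _ _.
apply: segment_of_norm_affine => //.
by rewrite (le_trans _ h)// le_eqVlt; apply/orP/or_introl/eqP; congr `|_|; rewrite /g; ring.
Qed.

(** The slope [c1 + c5 * w] in [x] has absolute value at least [1 / 10 - 1 / 20] for all [|w| <= 1],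
    so [x] lies in a segment of length at most [40 * s]. *)
Lemma lebesgue4_schubert_slope c0 c1 c2 c3 c4 c5 s : 0 <= s ->
  1 / 10 <= `|c1| -> `|c5| <= 1 / 20 ->
  (lebesgue4 (schubert_nbhd c0 c1 c2 c3 c4 c5 s) <= (320 * s)%:E)%E.
Proof.
move=> s0 c1l c5u.
rewrite (_ : 320 * s = 2 * (160 * s)); last by ring.
apply: lebesgue4_le_slices; first exact: measurable_schubert_nbhd.
move=> w; have [w1|w1] := leP `|w : R| 1; last first.
  exists 0, 0, 0, 0, 0; split=> //; first by rewrite !mul0r; lra.
  by split=> [x y z|y z]; last exists 0 => x; move=> [[_ /= h] _];
    rewrite leNgt w1 in h.
pose g : R := c1 + c5 * w.
have gl : 1 / 20 <= `|g|.
  have : `|c5 * w| <= 1 / 20.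
    by rewrite normrM -[1 / 20]mulr1; apply: ler_pM.
  have := ler_normB g (c5 * w); rewrite /g addrK; lra.
have g0 : g != 0 by rewrite -normr_gt0; lra.
exists (2 * (s / `|g|)), 2, 2, (-1), (-1); split=> //.
- by rewrite mulr_ge0// divr_ge0.
- rewrite (_ : _ * 2 = 8 * s / `|g|); last by field; rewrite normr_eq0.
  rewrite ler_pdivrMr; last by lra.
  by have : s * (1 / 20) <= s * `|g| by [exact: ler_wpM2l]; lra.
split.
  move=> x y z [[[[/= hx hy] hz] hw] _].
  move: hy hz hw; rewrite !ler_norml; split; lra.
move=> y z.
exists (- ((c0 + c2 * y + c3 * z + c4 * w - c5 * (z * y)) / g) - s / `|g|).
move=> x [_ /=]; rewrite /schubert /= => h.
apply: segment_of_norm_affine => //.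
by rewrite (le_trans _ h)// le_eqVlt; apply/orP/or_introl/eqP; congr `|_|; rewrite /g; ring.
Qed.

(** On the cube the polynomial is at least [9 / 10 - 4 / 10 - 2 / 20 = 2 / 5] in absolute value.
    Thus the set is empty for [s < 2 / 5], and otherwise the measure [16] of the cube is at most
    [40 * s]. *)
Lemma lebesgue4_schubert_const c0 c1 c2 c3 c4 c5 s : 0 <= s ->
  9 / 10 <= `|c0| -> `|c1| <= 1 / 10 -> `|c2| <= 1 / 10 -> `|c3| <= 1 / 10 ->
  `|c4| <= 1 / 10 -> `|c5| <= 1 / 20 ->
  (lebesgue4 (schubert_nbhd c0 c1 c2 c3 c4 c5 s) <= (40 * s)%:E)%E.
Proof.
move=> s0 h0 h1 h2 h3 h4 h5.
rewrite (_ : 40 * s = 2 * (20 * s)); last by ring.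
apply: lebesgue4_le_slices; first exact: measurable_schubert_nbhd.
have [sl|sg] := leP (2 / 5) s.
  move=> w; exists 2, 2, 2, (-1), (-1); split=> //; first by lra.
  split.
    move=> x y z [[[[/= hx hy] hz] hw] _].
    by move: hy hz hw; rewrite !ler_norml; split; lra.
  by move=> y z; exists (-1) => x [[[[/= hx _] _] _] _];
    move: hx; rewrite ler_norml; lra.
have nb0 l : ~ schubert_nbhd c0 c1 c2 c3 c4 c5 s l.
  move=> [[[[/= hx hy] hz] hw]].
  apply/negP; rewrite -ltNge (lt_le_trans sg)//.
  have bnd (a b p : R) : `|a| <= p -> `|b| <= 1 -> - p <= a * b <= p.
    move=> ha hb; rewrite -ler_norml normrM -[p]mulr1.
    by apply: ler_pM.
  have h1' := bnd _ _ _ h1 hx; have h2' := bnd _ _ _ h2 hy.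
  have h3' := bnd _ _ _ h3 hz; have h4' := bnd _ _ _ h4 hw.
  have n1 (a b : R) : `|a| <= 1 -> `|b| <= 1 -> `|a * b| <= 1.
    by move=> ha hb; rewrite normrM -[1]mulr1; apply: ler_pM.
  have h5' := bnd _ _ _ h5 (n1 _ _ hx hw); have h6' := bnd _ _ _ h5 (n1 _ _ hz hy).
  rewrite /schubert mulrBr.
  by move: h0; rewrite !ler_normr => /orP[h0|h0]; apply/orP; [left|right]; lra.
move=> w; exists 0, 0, 0, 0, 0; split=> //; first by rewrite !mul0r; lra.
by split=> [x y z|y z]; last exists 0 => x; move=> /nb0.
Qed.

End Schubert.

(** * Symmetries of the parameters, and the measure bound for arbitrary coefficients *)

Section Symmetry.
Context {R : realType}.
Local Notation lam := (@lebesgue_measure R).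
Implicit Types (c s w x y z : R) (l : params R).

Definition swap_cols (l : params R) : params R :=
  (l.1.1.2, l.1.1.1, l.2, l.1.2).

Definition swap_rows (l : params R) : params R :=
  (l.1.2, l.2, l.1.1.1, l.1.1.2).

Definition preserves4 (phi : params R -> params R) : Prop :=
  forall S, measurable S ->
    measurable (phi @^-1` S) /\ lebesgue4 (phi @^-1` S) = lebesgue4 S.

Lemma preserves4_comp phi psi :
  preserves4 phi -> preserves4 psi -> preserves4 (phi \o psi).
Proof.
move=> phiP psiP S mS; have [mphi phiE] := phiP _ mS.
have [mpsi psiE] := psiP _ mphi; split; [exact: mpsi|exact: etrans psiE phiE].
Qed.

Local Notation lam2 := (prod_measure lam lam).
Local Notation lam3 := (prod_measure lam2 lam).

(** Adjacent transpositions generate the symmetries used below. In the left-nested product each one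
    exchanges the two innermost factors or the last two factors at some level. *)
Lemma preserves4_swap12 :
  preserves4 (fun l => (l.1.1.2, l.1.1.1, l.1.2, l.2)).
Proof.
pose t2 (p : measurableTypeR R * measurableTypeR R) := (p.2, p.1).
have mt2 : measurable_fun setT t2 by exact/measurable_fun_pair.
pose t3 (p : measurableTypeR R * measurableTypeR R * measurableTypeR R) :=
  (t2 p.1, p.2).
have mt3 : measurable_fun setT t3.
  by apply/measurable_fun_pair => //; exact: measurableT_comp.
move=> S mS; split; rewrite ?lebesgue4E.
  rewrite -[X in measurable X]setTI.
  have mt4 : measurable_fun setT (fun p : params R => (t3 p.1, p.2)).
    by apply/measurable_fun_pair => //; exact: measurableT_comp.
  exact: mt4.
apply: (@product_measure_preserve _ _ _ _ _ lam3 lam t3) => // A mA.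
apply: (@product_measure_preserve _ _ _ _ _ lam2 lam t2) => // B mB.
exact: (@product_measure_swap _ _ _ _ _ lam lam).
Qed.

Lemma preserves4_swap23 :
  preserves4 (fun l => (l.1.1.1, l.1.2, l.1.1.2, l.2)).
Proof.
pose t3 (p : measurableTypeR R * measurableTypeR R * measurableTypeR R) :=
  (p.1.1, p.2, p.1.2).
have mt3 : measurable_fun setT t3.
  apply/measurable_fun_pair => //=; last exact: measurableT_comp.
  by apply/measurable_fun_pair => //=; exact: measurableT_comp.
move=> S mS; split; rewrite ?lebesgue4E.
  rewrite -[X in measurable X]setTI.
  have mt4 : measurable_fun setT (fun p : params R => (t3 p.1, p.2)).
    by apply/measurable_fun_pair => //; exact: measurableT_comp.
  exact: mt4.
apply: (@product_measure_preserve _ _ _ _ _ lam3 lam t3) => // A mA.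
exact: (@product_measure_swapr _ _ _ _ _ lam lam).
Qed.

Lemma preserves4_swap34 :
  preserves4 (fun l => (l.1.1.1, l.1.1.2, l.2, l.1.2)).
Proof.
move=> S mS; split; rewrite ?lebesgue4E.
  rewrite -[X in measurable X]setTI.
  have mt4 : measurable_fun setT (fun l => (l.1.1, l.2, l.1.2)).
    apply/measurable_fun_pair => //=; last exact: measurableT_comp.
    by apply/measurable_fun_pair => //=; exact: measurableT_comp.
  suff -> : (fun l => (l.1.1.1, l.1.1.2, l.2, l.1.2)) =
    (fun l => (l.1.1, l.2, l.1.2)) by exact: mt4.
  by apply/funext => -[[[]]].
rewrite -[RHS](@product_measure_swapr _ _ _ _ _ lam2 lam S mS).
congr (prod_measure _ _ _); apply/funext => -[[[]]//].
Qed.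

Lemma preserves4_swap_cols : preserves4 swap_cols.
Proof. exact: preserves4_comp preserves4_swap34 preserves4_swap12. Qed.

(** The row exchange is the column exchange conjugated by matrix transposition, which exchanges the
    second and third parameters. *)
Lemma preserves4_swap_rows : preserves4 swap_rows.
Proof.
exact: preserves4_comp preserves4_swap23
  (preserves4_comp preserves4_swap_cols preserves4_swap23).
Qed.

Lemma preserves4_rot : preserves4 (swap_rows \o swap_cols).
Proof. exact: preserves4_comp preserves4_swap_rows preserves4_swap_cols. Qed.

Lemma schubert_nbhd_cols c0 c1 c2 c3 c4 c5 s :
  schubert_nbhd c0 c1 c2 c3 c4 c5 s
  = swap_cols @^-1` schubert_nbhd c0 c2 c1 c4 c3 (- c5) s.
Proof.
have key l : schubert c0 c1 c2 c3 c4 c5 l =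
    schubert c0 c2 c1 c4 c3 (- c5) (swap_cols l).
  by case: l => -[[x y] z] w; rewrite /schubert /=; ring.
by apply/seteqP; split=> l; rewrite /schubert_nbhd /= key => -[[[[]]]].
Qed.

Lemma schubert_nbhd_rows c0 c1 c2 c3 c4 c5 s :
  schubert_nbhd c0 c1 c2 c3 c4 c5 s
  = swap_rows @^-1` schubert_nbhd c0 c3 c4 c1 c2 (- c5) s.
Proof.
have key l : schubert c0 c1 c2 c3 c4 c5 l =
    schubert c0 c3 c4 c1 c2 (- c5) (swap_rows l).
  by case: l => -[[x y] z] w; rewrite /schubert /=; ring.
by apply/seteqP; split=> l; rewrite /schubert_nbhd /= key => -[[[[]]]].
Qed.

Lemma schubert_nbhd_rot c0 c1 c2 c3 c4 c5 s :
  schubert_nbhd c0 c1 c2 c3 c4 c5 s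
  = (swap_rows \o swap_cols) @^-1` schubert_nbhd c0 c4 c3 c2 c1 c5 s.
Proof.
by rewrite schubert_nbhd_cols schubert_nbhd_rows opprK.
Qed.

Lemma lebesgue4U (A B : set (params R)) (a b : R) :
  measurable A -> measurable B ->
  (lebesgue4 A <= a%:E)%E -> (lebesgue4 B <= b%:E)%E ->
  (lebesgue4 (A `|` B) <= (a + b)%:E)%E.
Proof.
move=> mA mB Aa Bb; apply: le_trans (leeD Aa Bb).
exact: (@measureU2 _ _ _ (prod_measure lam3 lam)).
Qed.

Lemma le_lebesgue4 (A B : set (params R)) : measurable A -> measurable B ->
  A `<=` B -> (lebesgue4 A <= lebesgue4 B)%E.
Proof.
by move=> mA mB; apply: (@le_measure _ _ _ (prod_measure lam3 lam)); rewrite inE.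
Qed.

(** In the cyclic order [g1, g2, g4, g3] a largest value dominates its two neighbours. For the four
    partial derivatives these are the comparisons that define a pivot. *)
Lemma dominant_pair (g1 g2 g3 g4 : R) :
  [\/ g2 <= g1 /\ g3 <= g1, g1 <= g2 /\ g4 <= g2,
      g1 <= g3 /\ g4 <= g3 | g3 <= g4 /\ g2 <= g4].
Proof.
have [h12|h12] := leP g2 g1; have [h13|h13] := leP g3 g1.
- by apply: Or41.
- have [h34|h34] := leP g4 g3; [apply: Or43|apply: Or44]; split; lra.
- have [h24|h24] := leP g4 g2; [apply: Or42|apply: Or44]; split; lra.
- have [h23|h23] := leP g3 g2.
    have [h24|h24] := leP g4 g2; [apply: Or42|apply: Or44]; split; lra.
  have [h34|h34] := leP g4 g3; [apply: Or43|apply: Or44]; split; lra.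
Qed.

(** Row and column exchanges carry any partial derivative to the first one, so four pivot sets cover
    the neighborhood, and [512 = 4 * 128]. *)
Lemma lebesgue4_schubert_large c0 c1 c2 c3 c4 c5 s : 0 <= s ->
  `|c1| <= 1 -> `|c2| <= 1 -> `|c3| <= 1 -> `|c4| <= 1 ->
  1 / 20 <= `|c5| <= 1 ->
  (lebesgue4 (schubert_nbhd c0 c1 c2 c3 c4 c5 s) <= (512 * (100 * s))%:E)%E.
Proof.
move=> s0 h1 h2 h3 h4 h5.
have h5N : 1 / 20 <= `|- c5| <= 1 by rewrite normrN.
pose P1 := schubert_pivot c0 c1 c2 c3 c4 c5 s.
pose P2 := swap_cols @^-1` schubert_pivot c0 c2 c1 c4 c3 (- c5) s.
pose P3 := swap_rows @^-1` schubert_pivot c0 c3 c4 c1 c2 (- c5) s.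
pose P4 := (swap_rows \o swap_cols) @^-1` schubert_pivot c0 c4 c3 c2 c1 c5 s.
have mP1 : measurable P1 by exact: measurable_schubert_pivot.
have [mP2 P2E] := preserves4_swap_cols
  (measurable_schubert_pivot c0 c2 c1 c4 c3 (- c5) s).
have [mP3 P3E] := preserves4_swap_rows
  (measurable_schubert_pivot c0 c3 c4 c1 c2 (- c5) s).
have [mP4 P4E] := preserves4_rot
  (measurable_schubert_pivot c0 c4 c3 c2 c1 c5 s).
have le1 : (lebesgue4 P1 <= (128 * (100 * s))%:E)%E.
  exact: lebesgue4_schubert_pivot.
have le2 : (lebesgue4 P2 <= (128 * (100 * s))%:E)%E.
  by rewrite P2E; exact: lebesgue4_schubert_pivot.
have le3 : (lebesgue4 P3 <= (128 * (100 * s))%:E)%E.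
  by rewrite P3E; exact: lebesgue4_schubert_pivot.
have le4 : (lebesgue4 P4 <= (128 * (100 * s))%:E)%E.
  by rewrite P4E; exact: lebesgue4_schubert_pivot.
have sub : schubert_nbhd c0 c1 c2 c3 c4 c5 s `<=` P1 `|` P2 `|` (P3 `|` P4).
  move=> l nl.
  have nl2 := nl; rewrite schubert_nbhd_cols in nl2.
  have nl3 := nl; rewrite schubert_nbhd_rows in nl3.
  have nl4 := nl; rewrite schubert_nbhd_rot in nl4.
  case: l nl nl2 nl3 nl4 => -[[x y] z] w nl nl2 nl3 nl4.
  rewrite /P1 /P2 /P3 /P4 /schubert_pivot /swap_cols /swap_rows /=.
  rewrite !mulNr !opprK.
  have [[? ?]|[? ?]|[? ?]|[? ?]] := dominant_pair
    `|c1 + c5 * w| `|c2 - c5 * z| `|c3 - c5 * y| `|c4 + c5 * x|.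
  - by left; left; split; [split|].
  - by left; right; split; [split|].
  - by right; left; split; [split|].
  - by right; right; split; [split|].
apply: le_trans (le_lebesgue4 _ _ sub) _.
- exact: measurable_schubert_nbhd.
- exact: measurableU (measurableU _ _ mP1 mP2) (measurableU _ _ mP3 mP4).
have -> : 512 * (100 * s) = (128 * (100 * s) + 128 * (100 * s))
  + (128 * (100 * s) + 128 * (100 * s)) by ring.
exact: (lebesgue4U (measurableU _ _ mP1 mP2) (measurableU _ _ mP3 mP4)
  (lebesgue4U mP1 mP2 le1 le2) (lebesgue4U mP3 mP4 le3 le4)).
Qed.

(** Either [c5] is not small, or some linear coefficient is at least [1 / 10] and a symmetry makes
    it [c1], or all of these are small and the normalization forces [|c0| >= 9 / 10]. *)
Lemma lebesgue4_schubert_unit c0 c1 c2 c3 c4 c5 s : 0 <= s ->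
  c0 ^+ 2 + c1 ^+ 2 + c2 ^+ 2 + c3 ^+ 2 + c4 ^+ 2 + c5 ^+ 2 = 1 ->
  (lebesgue4 (schubert_nbhd c0 c1 c2 c3 c4 c5 s) <= (512 * (100 * s))%:E)%E.
Proof.
move=> s0 c1E.
have n1 c : c ^+ 2 <= 1 -> `|c| <= 1.
  by rewrite -real_normK ?num_real// => h; rewrite -(expr_le1 (n := 2)).
have := (sqr_ge0 c0, sqr_ge0 c1, sqr_ge0 c2, sqr_ge0 c3, sqr_ge0 c4, sqr_ge0 c5).
move=> [[[[[q0 q1] q2] q3] q4] q5].
have h1 : `|c1| <= 1 by apply: n1; lra.
have h2 : `|c2| <= 1 by apply: n1; lra.
have h3 : `|c3| <= 1 by apply: n1; lra.
have h4 : `|c4| <= 1 by apply: n1; lra.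
have h5 : `|c5| <= 1 by apply: n1; lra.
have [l5|/ltW l5] := leP (1 / 20) `|c5|.
  by apply: lebesgue4_schubert_large => //; rewrite l5.
have l5N : `|- c5| <= 1 / 20 by rewrite normrN.
have slope : ((320 * s)%:E <= (512 * (100 * s))%:E)%E by rewrite lee_fin; lra.
have [l1|/ltW l1] := leP (1 / 10) `|c1|.
  exact: le_trans (lebesgue4_schubert_slope _ _ _ _ _ _ _) slope.
have [l2|/ltW l2] := leP (1 / 10) `|c2|.
  rewrite schubert_nbhd_cols.
  have [_ ->] := preserves4_swap_cols
    (measurable_schubert_nbhd c0 c2 c1 c4 c3 (- c5) s).
  exact: le_trans (lebesgue4_schubert_slope _ _ _ _ _ _ _) slope.
have [l3|/ltW l3] := leP (1 / 10) `|c3|.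
  rewrite schubert_nbhd_rows.
  have [_ ->] := preserves4_swap_rows
    (measurable_schubert_nbhd c0 c3 c4 c1 c2 (- c5) s).
  exact: le_trans (lebesgue4_schubert_slope _ _ _ _ _ _ _) slope.
have [l4|/ltW l4] := leP (1 / 10) `|c4|.
  rewrite schubert_nbhd_rot.
  have [_ ->] := preserves4_rot
    (measurable_schubert_nbhd c0 c4 c3 c2 c1 c5 s).
  exact: le_trans (lebesgue4_schubert_slope _ _ _ _ _ _ _) slope.
apply: le_trans (lebesgue4_schubert_const _ _ _ _ _ _ _) _ => //; last first.
  by rewrite lee_fin; lra.
have sq c : `|c| <= 1 / 10 -> c ^+ 2 <= 1 / 100.
  move=> hc; rewrite -real_normK ?num_real//.
  have : `|c| ^+ 2 <= (1 / 10) ^+ 2 by rewrite lerXn2r ?nnegrE//; lra.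
  lra.
have := (sq _ l1, sq _ l2, sq _ l3, sq _ l4, sq c5) => -[[[[g1 g2] g3] g4] g5].
have g5' := g5 (le_trans l5 _).
have : (9 / 10) ^+ 2 <= `|c0| ^+ 2.
  rewrite real_normK ?num_real//; have : c5 ^+ 2 <= 1 / 100 by apply: g5; lra.
  lra.
by rewrite ler_pXn2r ?nnegrE//; lra.
Qed.

Lemma lebesgue4_schubert_nbhd c0 c1 c2 c3 c4 c5 N s : 0 <= s -> 0 < N ->
  c0 ^+ 2 + c1 ^+ 2 + c2 ^+ 2 + c3 ^+ 2 + c4 ^+ 2 + c5 ^+ 2 = N ^+ 2 ->
  (lebesgue4 (schubert_nbhd c0 c1 c2 c3 c4 c5 (N * s)) <= (512 * (100 * s))%:E)%E.
Proof.
move=> s0 N0 cN.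
suff -> : schubert_nbhd c0 c1 c2 c3 c4 c5 (N * s) =
    schubert_nbhd (c0 / N) (c1 / N) (c2 / N) (c3 / N) (c4 / N) (c5 / N) s.
  apply: lebesgue4_schubert_unit => //.
  by rewrite !expr_div_n -!mulrDl cN divff// expf_neq0// gt_eqF.
have key l : (`|schubert c0 c1 c2 c3 c4 c5 l| <= N * s) =
  (`|schubert (c0 / N) (c1 / N) (c2 / N) (c3 / N) (c4 / N) (c5 / N) l| <= s).
  rewrite -ler_pdivrMl// -{1}[N^-1]gtr0_norm ?invr_gt0// -normrM.
  by congr (`|_| <= _); rewrite /schubert; field; rewrite gt_eqF.
by apply/seteqP; split=> l [Cl]; rewrite /schubert_nbhd /= ?key => h; split;
  rewrite //= ?key.
Qed.

End Symmetry.

(** * Counting reduced pairs of integral vectors *)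

Section Counting.
Implicit Types (u v : 'rV[int]_4) (m r Y : nat).

Definition idot u v : int := \sum_i u 0 i * v 0 i.

Definition gram u v : int := idot u u * idot v v - idot u v ^+ 2.

Lemma size_flatten_le (S T : eqType) (f : S -> seq T) (s : seq S) n :
  (forall x, x \in s -> (size (f x) <= n)%N) ->
  (size (flatten [seq f x | x <- s]) <= size s * n)%N.
Proof.
elim: s => //= x s IH fn; rewrite size_cat mulSn leq_add ?fn ?mem_head//.
by apply: IH => y ys; rewrite fn// inE ys orbT.
Qed.

Definition seg r : seq int := [seq k%:Z - r%:Z | k <- iota 0 (2 * r + 1)].

Lemma size_seg r : size (seg r) = (2 * r + 1)%N.
Proof. by rewrite size_map size_iota. Qed.

Lemma mem_seg r (x : int) : `|x| <= r%:Z -> x \in seg r.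
Proof.
move=> xr; apply/mapP; exists (absz (x + r%:Z)); last by lia.
by rewrite mem_iota; lia.
Qed.

Definition vec (i : 'I_4) (x a b c : int) : 'rV[int]_4 :=
  \row_j (if unlift i j is Some k then [:: a; b; c]`_k else x).

Lemma vecE i u :
  u = vec i (u 0 i) (u 0 (lift i 0)) (u 0 (lift i 1)) (u 0 (lift i 2%:R)).
Proof.
apply/rowP => j; rewrite mxE; case: unliftP => [k ->|->//].
by case: k => -[|[|[|//]]] ?; congr (u 0 (lift i _)); apply/val_inj.
Qed.

(** Coordinate [i] has its own list of candidates because the other three leave it few choices: by
    the sup norm for a first vector, by the inner product for a second one. *)
Definition fill (i : 'I_4) r (xs : int -> int -> int -> seq int) :
    seq 'rV[int]_4 :=
  flatten [seq flatten [seq flatten [seq [seq vec i x a b c | x <- xs a b c]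
    | c <- seg r] | b <- seg r] | a <- seg r].

Lemma size_fill i r xs n : (forall a b c, (size (xs a b c) <= n)%N) ->
  (size (fill i r xs) <= (2 * r + 1) ^ 3 * n)%N.
Proof.
move=> xn; rewrite !expnS expn0 muln1 -!mulnA -!size_seg.
do 3![apply: size_flatten_le => ? _].
by rewrite size_map.
Qed.

Lemma mem_fill i r xs u : (forall j, `|u 0 j| <= r%:Z) ->
  u 0 i \in xs (u 0 (lift i 0)) (u 0 (lift i 1)) (u 0 (lift i 2%:R)) ->
  u \in fill i r xs.
Proof.
move=> ur ui; apply/flatten_mapP; exists (u 0 (lift i 0)); first exact: mem_seg.
apply/flatten_mapP; exists (u 0 (lift i 1)); first exact: mem_seg.
apply/flatten_mapP; exists (u 0 (lift i 2%:R)); first exact: mem_seg.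
by apply/mapP; exists (u 0 i) => //; exact: vecE.
Qed.

Definition first_vectors m i : seq 'rV[int]_4 :=
  fill i m (fun _ _ _ => [:: m%:Z; - m%:Z]).

(** The quotient is the rounded value of coordinate [i] at which the inner product with [u] would
    vanish. *)
Definition second_vectors m r u i : seq 'rV[int]_4 :=
  fill i r (fun a b c =>
    [seq divz (- (u 0 (lift i 0) * a + u 0 (lift i 1) * b
          + u 0 (lift i 2%:R) * c)) (u 0 i) + t | t <- seg (2 * m + 1)]).

(* [m] is the sup norm of the first vector, attained at [i].  The other
   coordinates of the second vector are at most [Y / m], and the coordinate [i]
   is confined by the inner product condition to an interval of length O(m). *)
Definition short_pairs Y : seq ('rV[int]_4 * 'rV[int]_4) :=
  flatten [seq flatten [seq flatten [seq [seq (u, v)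
    | v <- second_vectors m (Y %/ m) u i] | u <- first_vectors m i]
    | i <- enum 'I_4] | m <- [seq m <- iota 1 Y | (m * m <= Y)%N]].

(** The second bound carries the induction: if [n.+1 ^ 2 <= Y], the new sum is at most
    [n ^ 2 + n.+1 <= n.+1 ^ 2 <= Y]. *)
Lemma sum_sqrt_le Y n :
  (\sum_(m <- [seq m <- iota 1 n | (m * m <= Y)%N]) m <= Y)%N /\
  (\sum_(m <- [seq m <- iota 1 n | (m * m <= Y)%N]) m <= n ^ 2)%N.
Proof.
elim: n => [|n [IH1 IH2]]; first by rewrite !big_nil.
rewrite -[in iota _ _](addn1 n) iotaD filter_cat big_cat /= add1n.
case: ifP => nY; rewrite ?big_cons big_nil; first by split; nia.
by split; [lia|nia].
Qed.

(** For each [m] there are [O(m ^ 3)] first vectors and [O((Y / m) ^ 3 * m)] second ones, hence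
    [O(Y ^ 3 * m)] pairs; the admissible [m] sum to at most [Y]. *)
Lemma size_short_pairs Y : (size (short_pairs Y) <= 200 * 300 * Y ^ 4)%N.
Proof.
rewrite /short_pairs size_flatten sumnE !big_map.
apply: leq_trans (_ : (\sum_(m <- [seq m <- iota 1 Y | (m * m <= Y)%N])
    (200 * 300 * Y ^ 3) * m <= _)%N); last first.
  by rewrite -big_distrr /= (expnSr _ 3) mulnA leq_mul2l (sum_sqrt_le Y Y).1 orbT.
rewrite big_seq [leqRHS]big_seq; apply: leq_sum => m.
rewrite mem_filter mem_iota => /andP[mmY /andP[m0 mY]].
set r := (Y %/ m)%N.
have r1 : (1 <= r)%N by rewrite divn_gt0//; lia.
have rm : (r * m <= Y)%N by exact: leq_trunc_div.
apply: (@leq_trans (4 * (((2 * m + 1) ^ 3 * 2)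
    * ((2 * r + 1) ^ 3 * (4 * m + 3))))%N).
  rewrite -[X in (X * _)%N](size_enum_ord 4).
  apply: size_flatten_le => i _.
  apply: leq_trans (size_flatten_le (n := (2 * r + 1) ^ 3 * (4 * m + 3)) _) _.
    move=> u _; rewrite size_map; apply: size_fill => a b c.
    by rewrite size_map size_seg; lia.
  by rewrite leq_mul2r size_fill ?orbT.
have h1 : (2 * m + 1 <= 3 * m)%N by lia.
have h2 : (2 * r + 1 <= 3 * r)%N by lia.
have h3 : (4 * m + 3 <= 7 * m)%N by lia.
apply: (@leq_trans (4 * (((3 * m) ^ 3 * 2) * ((3 * r) ^ 3 * (7 * m))))%N).
  by rewrite leq_mul2l; apply: leq_mul; [|apply: leq_mul => //];
    rewrite ?leq_mul2r ?leq_exp2r// ?h1 ?orbT.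
have rm3 : ((r * m) ^ 3 <= Y ^ 3)%N by rewrite leq_exp2r.
move: rm3; rewrite !expnMn; move: (r ^ 3)%N (m ^ 3)%N (Y ^ 3)%N => a b c abc.
have : (a * b * m <= c * m)%N by rewrite leq_mul2r abc orbT.
by nia.
Qed.

Lemma sqr_coord_le u j : u 0 j ^+ 2 <= idot u u.
Proof.
rewrite /idot (bigD1 j) //= -expr2 lerDl.
by apply: sumr_ge0 => k _; rewrite -expr2 sqr_ge0.
Qed.

Lemma mem_short_pairs u v Y : 0 < idot u u -> idot u u <= idot v v ->
  2 * `|idot u v| <= idot u u -> idot u u * idot v v <= Y%:Z ^+ 2 ->
  (u, v) \in short_pairs Y.
Proof.
move=> u0 uv duv uvY.
pose f j := absz (u 0 j); 
have [i umax] : exists i, forall j, (f j <= f i)%N.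
  by case: (@arg_maxnP _ (0 : 'I_4) xpredT f isT) => i _ fi; exists i => j; exact: fi.
rewrite {}/f in umax; set m := absz (u 0 i) in umax.
have uim : u 0 i ^+ 2 = m%:Z ^+ 2 by rewrite /m; nia.
have uu4 : idot u u <= 4 * m%:Z ^+ 2.
  apply: le_trans (_ : \sum_(j < 4) m%:Z ^+ 2 <= _).
    apply: ler_sum => j _; have := umax j; rewrite -expr2; nia.
  by rewrite sumr_const card_ord; lia.
have m0 : (0 < m)%N by case: m uu4 {uim umax} => [|//]; lia.
have mu := sqr_coord_le u i; rewrite uim in mu.
(* Indeed [m ^ 4 <= |u|^2 |u|^2 <= |u|^2 |v|^2 <= Y ^ 2]. *)
have mmY : (m * m <= Y)%N by nia.
have vY j : `|v 0 j| <= (Y %/ m)%N%:Z.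
  have vj := sqr_coord_le v j.
  suff : (absz (v 0%R j) <= Y %/ m)%N by lia.
  rewrite leq_divRL//.
  have : ((absz (v 0 j))%:Z * m%:Z) ^+ 2 <= Y%:Z ^+ 2.
    rewrite exprMn; apply: le_trans uvY; rewrite mulrC.
    by apply: ler_pM; rewrite ?sqr_ge0// abszE real_normK ?num_real.
  by rewrite ler_pXn2r ?nnegrE//; lia.
apply/flatten_mapP; exists m.
  by rewrite mem_filter mem_iota mmY; nia.
apply/flatten_mapP; exists i; first by rewrite mem_enum.
apply/flatten_mapP; exists u.
  apply: mem_fill => [j|]; first by have := umax j; lia.
  by rewrite !inE; lia.
apply/map_f; apply: mem_fill => //.
set rest := u 0 (lift i 0) * _ + _ + _.
have uvE : idot u v = u 0 i * v 0 i + rest.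
  rewrite /idot (bigD1_ord i) //= !big_ord_recl big_ord0 addr0 /rest.
  rewrite !addrA; congr (_ + _ + u 0 _ * v 0 _ + u 0 _ * v 0 _); congr lift; exact/val_inj.
apply/mapP; exists (v 0 i - divz (- rest) (u 0 i)); last by lia.
apply: mem_seg.
have ui0 : u 0 i != 0 by lia.
have dE := divz_eq (- rest) (u 0 i).
have r0 := modz_ge0 (- rest) ui0.
have rl := ltz_mod (- rest) ui0.
set q := divz _ _ in dE *; set rho := modz _ _ in dE r0 rl.
(* Here [|idot u v| <= 2 * m ^ 2] and [rho < m], so dividing by [|u 0 i| = m] gives
   [|v 0 i - q| < 2 * m + 1]. *)
have E : u 0 i * (v 0 i - q) = idot u v + rho by rewrite uvE; nia.
have : `|u 0 i| * `|v 0 i - q| <= `|idot u v| + rho.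
  by rewrite -normrM E; lia.
nia.
Qed.

End Counting.

(** * Angles and determinants *)

Section Angles.
Context {R : realType}.
Implicit Types (a b c d w z : 'rV[R]_4) (i j : 'I_4).

Definition plucker a b i j : R := a 0 i * b 0 j - a 0 j * b 0 i.

(* The determinant of [a, b, c, d], with coordinates in the order
   [i1, i2, i3, i4], expanded along the first two vectors. *)
Definition pairing i1 i2 i3 i4 a b c d : R :=
  plucker a b i1 i2 * plucker c d i3 i4 - plucker a b i1 i3 * plucker c d i2 i4
  + plucker a b i1 i4 * plucker c d i2 i3 + plucker a b i2 i3 * plucker c d i1 i4
  - plucker a b i2 i4 * plucker c d i1 i3 + plucker a b i3 i4 * plucker c d i1 i2.

Definition dot_gram a b : R := dotp a a * dotp b b - dotp a b ^+ 2.

Lemma dotpE w z : dotp w z = \sum_i w 0 i * z 0 i.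
Proof. by rewrite /dotp mxE; apply: eq_bigr => i _; rewrite mxE. Qed.

Lemma dotpC w z : dotp w z = dotp z w.
Proof. by rewrite !dotpE; apply: eq_bigr => i _; rewrite mulrC. Qed.

Lemma dotp_lin2 (x y : R) a b z :
  dotp (x *: a + y *: b) z = x * dotp a z + y * dotp b z.
Proof. by rewrite /dotp mulmxDl -!scalemxAl !mxE. Qed.

Lemma lin2E (x y : R) a b i : (x *: a + y *: b) 0 i = x * a 0 i + y * b 0 i.
Proof. by rewrite !mxE. Qed.

Lemma pairing_swap i1 i2 i3 i4 a b c d :
  pairing i1 i2 i3 i4 a b c d = - pairing i1 i2 i3 i4 a c b d.
Proof. by rewrite /pairing /plucker; ring. Qed.

Lemma plucker_lin2 (x y s t : R) a b i j :
  plucker (x *: a + y *: b) (s *: a + t *: b) i j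
  = (x * t - y * s) * plucker a b i j.
Proof. by rewrite /plucker !mxE; ring. Qed.

Lemma pairing_lin2 i1 i2 i3 i4 (x y s t x' y' s' t' : R) a b c d :
  pairing i1 i2 i3 i4 (x *: a + y *: b) (s *: a + t *: b)
    (x' *: c + y' *: d) (s' *: c + t' *: d)
  = (x * t - y * s) * (x' * t' - y' * s') * pairing i1 i2 i3 i4 a b c d.
Proof. by rewrite /pairing !plucker_lin2; ring. Qed.

Lemma cauchy_schwarz6 (x1 x2 x3 x4 x5 x6 y1 y2 y3 y4 y5 y6 : R) :
  (x1 * y1 + x2 * y2 + x3 * y3 + x4 * y4 + x5 * y5 + x6 * y6) ^+ 2 <=
  (x1 ^+ 2 + x2 ^+ 2 + x3 ^+ 2 + x4 ^+ 2 + x5 ^+ 2 + x6 ^+ 2) *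
  (y1 ^+ 2 + y2 ^+ 2 + y3 ^+ 2 + y4 ^+ 2 + y5 ^+ 2 + y6 ^+ 2).
Proof.
rewrite -subr_ge0.
pose x k : R := [:: x1; x2; x3; x4; x5; x6]`_k.
pose y k : R := [:: y1; y2; y3; y4; y5; y6]`_k.
(* Lagrange's identity. *)
suff -> : (x1 ^+ 2 + x2 ^+ 2 + x3 ^+ 2 + x4 ^+ 2 + x5 ^+ 2 + x6 ^+ 2) *
    (y1 ^+ 2 + y2 ^+ 2 + y3 ^+ 2 + y4 ^+ 2 + y5 ^+ 2 + y6 ^+ 2) -
    (x1 * y1 + x2 * y2 + x3 * y3 + x4 * y4 + x5 * y5 + x6 * y6) ^+ 2 =
    \sum_(l < 6) \sum_(k < l) (x k * y l - x l * y k) ^+ 2.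
  by apply: sumr_ge0 => l _; apply: sumr_ge0 => k _; exact: sqr_ge0.
by rewrite !big_ord_recr !big_ord0 /= /x /y /=; ring.
Qed.

Section Coordinates.
Variables (i1 i2 i3 i4 : 'I_4).
Hypothesis U : uniq [:: i1; i2; i3; i4].

Lemma mem_coords i : i \in [:: i1; i2; i3; i4].
Proof.
have := card_uniqP U => cardE.
suff /(_ i) -> : [:: i1; i2; i3; i4] =i 'I_4 by [].
by apply/subset_cardP; rewrite ?subset_predT// cardE card_ord.
Qed.

Lemma sum_coords (f : 'I_4 -> R) : \sum_i f i = f i1 + f i2 + f i3 + f i4.
Proof.
transitivity (\sum_(i in [:: i1; i2; i3; i4]) f i).
  by apply: eq_bigl => i; rewrite mem_coords.
by rewrite -big_uniq//= !big_cons big_nil addr0 !addrA.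
Qed.

Lemma forall_coords (P : 'I_4 -> Prop) : P i1 -> P i2 -> P i3 -> P i4 ->
  forall i, P i.
Proof.
move=> P1 P2 P3 P4 i; have := mem_coords i.
by rewrite !inE => /or4P[] /eqP ->.
Qed.

(** Lagrange's identity, with the terms in the order of the coefficients in [pairing_chart]. *)
Lemma sum_plucker_sqr a b :
  plucker a b i3 i4 ^+ 2 + plucker a b i1 i4 ^+ 2 + plucker a b i2 i4 ^+ 2
  + plucker a b i1 i3 ^+ 2 + plucker a b i2 i3 ^+ 2 + plucker a b i1 i2 ^+ 2
  = dot_gram a b.
Proof. by rewrite /dot_gram !dotpE !sum_coords /plucker; ring. Qed.

Lemma dot_gram_ge0 a b : 0 <= dot_gram a b.
Proof. by rewrite -sum_plucker_sqr !addr_ge0// sqr_ge0. Qed.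

(** The determinant is the inner product of the Pluecker vector of [(a, b)] with that of [(c, d)],
    permuted and signed; Cauchy-Schwarz applies. *)
Lemma pairing_sqr_le a b c d :
  pairing i1 i2 i3 i4 a b c d ^+ 2 <= dot_gram a b * dot_gram c d.
Proof.
rewrite -!sum_plucker_sqr /pairing.
set x1 := plucker a b i1 i2; set x2 := plucker a b i1 i3.
set x3 := plucker a b i1 i4; set x4 := plucker a b i2 i3.
set x5 := plucker a b i2 i4; set x6 := plucker a b i3 i4.
set y1 := plucker c d i1 i2; set y2 := plucker c d i1 i3.
set y3 := plucker c d i1 i4; set y4 := plucker c d i2 i3.
set y5 := plucker c d i2 i4; set y6 := plucker c d i3 i4.
have := cauchy_schwarz6 x1 (- x2) x3 x4 (- x5) x6 y6 y5 y4 y3 y2 y1.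
by rewrite !sqrrN; move=> h; apply: le_trans (le_trans h _);
  rewrite le_eqVlt; apply/orP/or_introl/eqP; ring.
Qed.

(* For unit vectors [w], [z] of the two planes, complete [w] and [z] to bases of
   the same covolume as [(a, b)] and [(c, d)] by vectors orthogonal to them. *)
Lemma pairing_le_angle (x y x' y' : R) a b c d w z :
  w = x *: a + y *: b -> z = x' *: c + y' *: d ->
  dotp w w = 1 -> dotp z z = 1 ->
  pairing i1 i2 i3 i4 a b c d ^+ 2
    <= (1 - dotp w z ^+ 2) * (dot_gram a b * dot_gram c d).
Proof.
move=> wE zE w1 z1.
have complete (p q : R) e f v : v = p *: e + q *: f -> dotp v v = 1 ->
    exists s t, p * t - q * s = 1 /\
      dotp (s *: e + t *: f) (s *: e + t *: f) = dot_gram e f.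
  (* The vector [- dotp f v *: e + dotp e v *: f] is orthogonal to [v], and [p * t - q * s] becomes
     [dotp v v = 1]. *)
  move=> vE v1; exists (- dotp f v), (dotp e v).
  have pv : p * dotp e v + q * dotp f v = 1 by rewrite -dotp_lin2 -vE.
  split; first by rewrite mulrN opprK.
  rewrite dotp_lin2 !(dotpC _ (_ + _)) !dotp_lin2 /dot_gram.
  have ev : dotp e v = p * dotp e e + q * dotp e f.
    by rewrite dotpC vE dotp_lin2 (dotpC f e).
  have fv : dotp f v = p * dotp e f + q * dotp f f.
    by rewrite dotpC vE dotp_lin2.
  rewrite (dotpC f e) -[RHS]mul1r -pv ev fv; ring.
have [s [t [xt w'E]]] := complete _ _ _ _ _ wE w1.
have [s' [t' [xt' z'E]]] := complete _ _ _ _ _ zE z1.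
have -> : pairing i1 i2 i3 i4 a b c d =
    pairing i1 i2 i3 i4 w (s *: a + t *: b) z (s' *: c + t' *: d).
  by rewrite wE zE pairing_lin2 xt xt' !mul1r.
(* Regrouping puts [w] with [z], whose Gram determinant is [1 - dotp w z ^+ 2]; that of the two
   completing vectors is at most the product of their square norms. *)
rewrite pairing_swap sqrrN; apply: le_trans (pairing_sqr_le _ _ _ _) _.
rewrite [dot_gram w z]/dot_gram w1 z1 mul1r.
apply: ler_wpM2l; first by have := dot_gram_ge0 w z; rewrite /dot_gram w1 z1 mul1r.
by rewrite -w'E -z'E [leLHS]/dot_gram lerBlDr lerDl sqr_ge0.
Qed.

Definition chart_vector1 (l : params R) : 'rV[R]_4 :=
  delta_mx 0 i1 + l.1.1.1 *: delta_mx 0 i3 + l.1.2 *: delta_mx 0 i4.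

Definition chart_vector2 (l : params R) : 'rV[R]_4 :=
  delta_mx 0 i2 + l.1.1.2 *: delta_mx 0 i3 + l.2 *: delta_mx 0 i4.

Lemma chart_vectorE l :
  [/\ [/\ chart_vector1 l 0 i1 = 1, chart_vector1 l 0 i2 = 0,
         chart_vector1 l 0 i3 = l.1.1.1 & chart_vector1 l 0 i4 = l.1.2] &
      [/\ chart_vector2 l 0 i1 = 0, chart_vector2 l 0 i2 = 1,
         chart_vector2 l 0 i3 = l.1.1.2 & chart_vector2 l 0 i4 = l.2]].
Proof.
move: U; rewrite /= !inE !negb_or.
move=> /and4P[/and3P[n12 n13 n14] /andP[n23 n24] n34 _].
do !split; rewrite !mxE !eqxx /= ?(negPf n12) ?(negPf n13) ?(negPf n14)
  ?(negPf n23) ?(negPf n24) ?(negPf n34) 1?eq_sym ?(negPf n12) ?(negPf n13)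
  ?(negPf n14) ?(negPf n23) ?(negPf n24) ?(negPf n34)
  1?[i4 == _]eq_sym ?(negPf n34) /=; ring.
Qed.

Lemma mem_plane_chart l w : w \in plane i1 i2 i3 i4 l ->
  w = w 0 i1 *: chart_vector1 l + w 0 i2 *: chart_vector2 l.
Proof.
have [[e11 e12 e13 e14] [e21 e22 e23 e24]] := chart_vectorE l.
case: l e11 e12 e13 e14 e21 e22 e23 e24 => -[[l11 l12] l21] l22 /=.
move=> e11 e12 e13 e14 e21 e22 e23 e24 /(mem_plane _ _ _ _ _ _ _ _ _).1[w3 w4].
by apply/rowP; apply: forall_coords; rewrite lin2E ?e11 ?e12 ?e13 ?e14
  ?e21 ?e22 ?e23 ?e24 ?w3 ?w4; ring.
Qed.

(** The Pluecker coordinates of the chart basis are, up to sign, [1], the four parameters and their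
    determinant. *)
Lemma pairing_chart l c d :
  pairing i1 i2 i3 i4 (chart_vector1 l) (chart_vector2 l) c d =
  schubert (plucker c d i3 i4) (- plucker c d i1 i4) (- plucker c d i2 i4)
    (plucker c d i1 i3) (plucker c d i2 i3) (plucker c d i1 i2) l.
Proof.
have [[e11 e12 e13 e14] [e21 e22 e23 e24]] := chart_vectorE l.
rewrite /pairing /schubert.
move: (plucker c d) => p; rewrite /plucker.
by rewrite e11 e12 e13 e14 e21 e22 e23 e24; ring.
Qed.

(** On [param_dom] each of the six Pluecker coordinates of the chart basis has absolute value at
    most [1]. *)
Lemma chart_gram_le l : param_dom l ->
  dot_gram (chart_vector1 l) (chart_vector2 l) <= 6.
Proof.
have [[e11 e12 e13 e14] [e21 e22 e23 e24]] := chart_vectorE l.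
rewrite -sum_plucker_sqr /plucker e11 e12 e13 e14 e21 e22 e23 e24.
case: l {e11 e12 e13 e14 e21 e22 e23 e24} => -[[x y] z] w /= [].
rewrite !in_itv /= -!ler_norml => x1 y1 z1 w1 d1.
have sq (t : R) : `|t| <= 1 -> t ^+ 2 <= 1.
  by move=> t1; rewrite -real_normK ?num_real// expr_le1.
have := (sq _ x1, sq _ y1, sq _ z1, sq _ w1, sq _ d1).
move=> [[[[qx qy] qz] qw] qd]; rewrite mulr0 mulr1 !mul0r !mul1r subr0 !sub0r.
rewrite !subr0 !sqrrN; lra.
Qed.

End Coordinates.

Lemma dotp_ge0 w : 0 <= dotp w w.
Proof. by rewrite dotpE; apply: sumr_ge0 => i _; rewrite -expr2 sqr_ge0. Qed.

Lemma dotp_eq0 w : dotp w w = 0 -> w = 0.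
Proof.
rewrite dotpE => /eqP; rewrite psumr_eq0 => [/allP w0|i _]; last first.
  by rewrite -expr2 sqr_ge0.
apply/rowP => i; rewrite mxE; apply/eqP; rewrite -sqrf_eq0 expr2.
exact: w0 (mem_index_enum i).
Qed.

(** Ensures that the infimum in [psi] is taken over a nonempty set. *)
Lemma unit_vector (L : {vspace 'rV[R]_4}) : \dim L = 2%N ->
  exists2 w, w \in L & enorm w = 1.
Proof.
move=> dL; have p0 : vpick L != 0 by rewrite vpick0 -dimv_eq0 dL.
have e0 : 0 < enorm (vpick L).
  rewrite sqrtr_gt0 lt_def dotp_ge0 andbT; apply: contra p0 => /eqP.
  by move=> /dotp_eq0 ->.
exists ((enorm (vpick L))^-1 *: vpick L); first by rewrite memvZ ?memv_pick.
rewrite /enorm /dotp linearZ /= -scalemxAl -scalemxAr scalerA mxE -expr2.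
rewrite sqrtrM ?sqr_ge0// sqrtr_sqr gtr0_norm ?invr_gt0//.
by rewrite -[Num.sqrt (_ 0 0)]/(enorm _) mulVf// gt_eqF.
Qed.

Lemma sin_le_id (t : R) : 0 <= t -> sin t <= t.
Proof.
move=> t0.
have sin_cont : {within `[0, t], continuous (@sin R)}.
  by apply: continuous_subspaceT => x; exact: continuous_sin.
have [c _] := MVT_segment t0 (fun x _ => is_derive_sin x) sin_cont.
rewrite sin0 !subr0 => ->; rewrite ler_piMl//; exact: cos_le1.
Qed.

Lemma sqr_acos_ge (x : R) : -1 <= x <= 1 -> 1 - x ^+ 2 <= acos x ^+ 2.
Proof.
move=> x1; have a0 := acos_ge0 x1.
have xc : cos (acos x) = x by rewrite acosK// in_itv.
have := cos2Dsin2 (acos x); rewrite xc => e.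
have -> : 1 - x ^+ 2 = sin (acos x) ^+ 2 by rewrite -e; ring.
rewrite ler_sqr ?nnegrE ?sin_le_id//; apply: sin_ge0_pi.
by rewrite a0 acos_lepi.
Qed.

(** The hypothesis bounds the sine of every angle from below by [k], and [sin t <= t] for
    [t >= 0]. *)
Lemma psi_ge (L1 L2 : {vspace 'rV[R]_4}) (k : R) :
  \dim L1 = 2%N -> \dim L2 = 2%N -> 0 <= k ->
  (forall w z, w \in L1 -> z \in L2 -> dotp w w = 1 -> dotp z z = 1 ->
     k ^+ 2 <= 1 - dotp w z ^+ 2) ->
  k <= psi L1 L2.
Proof.
move=> d1 d2 k0 H; apply: lb_le_inf.
  have [w wL w1] := unit_vector d1; have [z zL z1] := unit_vector d2.
  by exists (angle w z), w, z.
move=> _ [w [z [wL zL w1 z1 ->]]]; rewrite /angle w1 z1 mulr1 divr1.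
have sq (v : 'rV[R]_4) : enorm v = 1 -> dotp v v = 1.
  rewrite /enorm => v1.
  by rewrite -[LHS]sqr_sqrtr ?dotp_ge0// v1 expr1n.
have kwz := H _ _ wL zL (sq _ w1) (sq _ z1).
have wz1 : -1 <= dotp w z <= 1.
  rewrite -ler_norml -(expr_le1 (n := 2))// real_normK ?num_real//.
  by have := sqr_ge0 k; lra.
rewrite -ler_sqr ?nnegrE ?acos_ge0//.
exact: le_trans kwz (sqr_acos_ge wz1).
Qed.

Definition int_row (u : 'rV[int]_4) : 'rV[R]_4 := map_mx intr u.

Lemma dotp_int_row u v : dotp (int_row u) (int_row v) = (idot u v)%:~R.
Proof.
rewrite dotpE /idot rmorph_sum; apply: eq_bigr => i _.
by rewrite !mxE -rmorphM.
Qed.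

Lemma dot_gram_int_row u v : dot_gram (int_row u) (int_row v) = (gram u v)%:~R.
Proof. by rewrite /dot_gram !dotp_int_row /gram rmorphB rmorphXn !rmorphM. Qed.

(** By [pairing_le_angle] the squared left side is at most [6 * dot_gram c d] times the squared sine
    of any angle between the planes; [3] serves as an upper bound for the square root of [6]. *)
Lemma schubert_le_psi i1 i2 i3 i4 (l : params R) (B : {vspace 'rV[R]_4})
    (c d : 'rV[R]_4) :
  uniq [:: i1; i2; i3; i4] -> param_dom l ->
  \dim (plane i1 i2 i3 i4 l) = 2%N -> \dim B = 2%N ->
  (forall z, z \in B -> exists y y', z = y *: c + y' *: d) ->
  0 < dot_gram c d ->
  `|schubert (plucker c d i3 i4) (- plucker c d i1 i4) (- plucker c d i2 i4)
     (plucker c d i1 i3) (plucker c d i2 i3) (plucker c d i1 i2) l|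
  <= 3 * Num.sqrt (dot_gram c d) * psi (plane i1 i2 i3 i4 l) B.
Proof.
move=> U ldom dA dB span g0; rewrite -pairing_chart//.
set P := pairing _ _ _ _ _ _ _ _.
have sg0 : 0 < 3 * Num.sqrt (dot_gram c d) by rewrite mulr_gt0// sqrtr_gt0.
rewrite mulrC -ler_pdivrMr//; apply: psi_ge => // w z wA /span[y [y' zE]] w1 z1.
have := pairing_le_angle U (mem_plane_chart U wA) zE w1 z1; rewrite -/P.
have := chart_gram_le U ldom; have := dot_gram_ge0 U w z.
rewrite /dot_gram w1 z1 mul1r -/(dot_gram c d) -/(dot_gram _ _).
set q := 1 - _; set D := dot_gram c d in g0 sg0 *.
set E := dot_gram _ _ => q0 E6 PE.
rewrite expr_div_n real_normK ?num_real// exprMn sqr_sqrtr ?(ltW g0)//.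
rewrite ler_pdivrMr; last by rewrite mulr_gt0// exprn_gt0.
apply: le_trans PE _.
apply: ler_wpM2l => //; apply: ler_wpM2r; [exact: ltW|lra].
Qed.

End Angles.

(** * Rational planes *)

Lemma det_mx2 (K : comNzRingType) (A : 'M[K]_2) :
  \det A = A 0 0 * A 1 1 - A 0 1 * A 1 0.
Proof.
have l00 : lift 0 0 = 1 :> 'I_2 by exact/val_inj.
have l10 : lift 1 0 = 0 :> 'I_2 by exact/val_inj.
rewrite (expand_det_row _ 0) !big_ord_recl big_ord0 l00 /cofactor !det_mx11 !mxE.
by rewrite l00 l10 /= expr0 expr1 mul1r addr0 mulN1r mulrN.
Qed.

Section RationalPlanes.
Context {R : realType}.
Implicit Types (u v : 'rV[int]_4).

Lemma idotC u v : idot u v = idot v u.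
Proof. by apply: eq_bigr => i _; rewrite mulrC. Qed.

Lemma idot_lin2 (x y : int) u v w :
  idot (x *: u + y *: v) w = x * idot u w + y * idot v w.
Proof.
rewrite /idot !mulr_sumr -big_split /=; apply: eq_bigr => i _.
by rewrite !mxE mulrDl !mulrA.
Qed.

Lemma idot_ge0 u : 0 <= idot u u.
Proof. by apply: sumr_ge0 => i _; rewrite -expr2 sqr_ge0. Qed.

Lemma idot_eq0 u : idot u u = 0 -> u = 0.
Proof.
move=> /eqP; rewrite psumr_eq0 => [/allP u0|i _]; last by rewrite -expr2 sqr_ge0.
apply/rowP => i; rewrite mxE; apply/eqP; rewrite -sqrf_eq0 expr2.
exact: u0 (mem_index_enum i).
Qed.

Lemma gramC u v : gram u v = gram v u.
Proof. by rewrite /gram (idotC u v) [idot u u * _]mulrC. Qed.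

Lemma gram_shear (k : int) u v : gram u (k *: u + 1 *: v) = gram u v.
Proof. by rewrite /gram !idot_lin2 !(idotC _ (_ + _)) !idot_lin2 (idotC v u); ring. Qed.

(* If the Gram determinant vanished, then the integral vector
   [<u, v> u - <u, u> v], of square norm [<u, u> gram u v], would be [0]. *)
Lemma gram_gt0 u v :
  (forall x y : int, x *: u + y *: v = 0 -> x = 0 /\ y = 0) -> 0 < gram u v.
Proof.
move=> free; rewrite ltNge; apply/negP => g0.
set p := idot u v *: u + (- idot u u) *: v.
have p2 : idot p p = idot u u * gram u v.
  by rewrite /p /gram idot_lin2 !(idotC _ (_ + _)) !idot_lin2 (idotC v u); ring.
have pp0 : idot p p = 0.
  by apply/eqP; rewrite eq_le idot_ge0 andbT p2 mulr_ge0_le0 ?idot_ge0.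
have [_ /eqP] := free _ _ (idot_eq0 pp0); rewrite oppr_eq0 => /eqP u0.
have e : 1 *: u + 0 *: v = 0 by rewrite (idot_eq0 u0) scaler0 scale0r addr0.
by have [] := free _ _ e.
Qed.

Lemma int_row_lin2 (x y : int) u v :
  int_row (x *: u + y *: v) = x%:~R *: int_row u + y%:~R *: int_row v :> 'rV[R]_4.
Proof. by apply/rowP => j; rewrite !mxE rmorphD !rmorphM. Qed.

Lemma rational_plane_gram (B : {vspace 'rV[R]_4}) : \dim B = 2%N ->
  rational_subspace B ->
  exists u v, [/\ int_row u \in B, int_row v \in B, 0 < gram u v &
    height B = Num.sqrt (gram u v)%:~R].
Proof.
move=> dB [M bM]; have hE := heightE bM; move: M bM hE; rewrite dB => M bM hE.
have [GM uM] := bM.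
have rowE i : exists2 u : 'rV[int]_4, int_row u \in B & row i M = int_row u.
  have [MB /mxOverP Mint] := GM i.
  exists (\row_j Num.floor (row i M 0 j)).
    rewrite (_ : int_row _ = row i M)//.
    by apply/rowP => j; rewrite mxE mxE floorK// Mint.
  by apply/rowP => j; rewrite [RHS]mxE mxE floorK// Mint.
have [u uB uE] := rowE 0; have [v vB vE] := rowE 1; exists u, v.
have ME : (M *m M^T) = \matrix_(i, j) dotp (row i M) (row j M).
  apply/matrixP => i j; rewrite !mxE /dotp mxE; apply: eq_bigr => k _.
  by rewrite !mxE.
have gE : \det (M *m M^T) = (gram u v)%:~R.
  rewrite -dot_gram_int_row /dot_gram ME det_mx2 !mxE -uE -vE expr2.
  by rewrite (dotpC (row 1 M)).
split => //; last by rewrite hE gE.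
apply: gram_gt0 => x y xy0.
(* Independence over the integers comes from the uniqueness of the coordinates of [0] in the
   Z-basis. *)
have G0 : int_points B 0 by split; [exact: mem0v|apply/mxOverP => i j; rewrite mxE].
have [c0 [_ c0u]] := uM _ G0.
pose c : 'rV[int]_2 := \row_j (if j == 0 then x else y).
have cE : 0 = map_mx intr c *m M.
  apply/rowP => j; have := congr1 (fun t => int_row t 0 j : R) xy0.
  have l00 : lift 0 0 = 1 :> 'I_2 by exact/val_inj.
  rewrite int_row_lin2 -uE -vE !mxE !big_ord_recl big_ord0 l00 !mxE /= addr0.
  by move=> ->.
have c0E : c0 = c by exact: c0u.
have : c0 = 0 by apply: c0u; rewrite map_mx0 mul0mx.
rewrite c0E => /rowP c00; have := c00 0; have := c00 1.
by rewrite !mxE.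
Qed.

Lemma plane_span (B : {vspace 'rV[R]_4}) u v : \dim B = 2%N ->
  int_row u \in B -> int_row v \in B -> 0 < gram u v ->
  forall z, z \in B -> exists y y' : R, z = y *: int_row u + y' *: int_row v.
Proof.
move=> dB uB vB g0 z zB.
have g0R : 0 < dot_gram (int_row u) (int_row v : 'rV[R]_4).
  by rewrite dot_gram_int_row ltr0z.
have spanE : <<[:: int_row u; int_row v]>>%VS = B.
  have fr : free [:: int_row u; int_row v : 'rV[R]_4].
    rewrite free_cons seq1_free span_seq1; apply/andP; split.
      apply: contraTN g0R => /vlineP[k ->]; rewrite -leNgt /dot_gram.
      have dZ (w : 'rV[R]_4) : dotp (k *: int_row v) w = k * dotp (int_row v) w.
        by rewrite -[k *: _]addr0 -[0](scale0r (int_row v)) dotp_lin2; ring.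
      by rewrite !dZ dotpC dZ; lra.
    apply: contraTN g0R => /eqP ->; rewrite -leNgt /dot_gram.
    have d0 (w : 'rV[R]_4) : dotp w 0 = 0 by rewrite /dotp trmx0 mulmx0 mxE.
    by rewrite !d0; lra.
  apply/eqP; rewrite eqEdim; apply/andP; split; last first.
    by rewrite dB; move: fr; rewrite /free => /eqP ->.
  by apply/span_subvP => w; rewrite !inE => /orP[] /eqP ->.
move: zB; rewrite -spanE span_cons span_seq1 => /memv_addP[a /vlineP[y ->]].
by case=> b /vlineP[y' ->] ->; exists y, y'.
Qed.

(* Take the pair of least [|u|^2 + |v|^2] among those of the right covolume. *)
Lemma reduced_pair (B : {vspace 'rV[R]_4}) : \dim B = 2%N ->
  rational_subspace B ->
  exists u v, [/\ int_row u \in B, int_row v \in B, 0 < gram u v,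
    height B = Num.sqrt (gram u v)%:~R &
    idot u u <= idot v v /\ 2 * `|idot u v| <= idot u u].
Proof.
move=> dB rB; have [u0 [v0 [u0B v0B g0 h0]]] := rational_plane_gram dB rB.
pose P n := `[< exists u v, [/\ int_row u \in B, int_row v \in B,
  gram u v = gram u0 v0 & absz (idot u u + idot v v) = n] >].
have exP : exists n, P n.
  by exists (absz (idot u0 u0 + idot v0 v0)); apply/asboolP; exists u0, v0.
have [n /asboolP[u [v [uB vB guv nE]]] nmin] := ex_minnP exP.
have shear u' v' : int_row u' \in B -> int_row v' \in B ->
    gram u' v' = gram u0 v0 -> absz (idot u' u' + idot v' v') = n ->
    2 * `|idot u' v'| <= idot u' u'.
  move=> u'B v'B g' n'.
  have le (e : int) : idot v' v' <= idot (e *: u' + 1 *: v') (e *: u' + 1 *: v').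
    have : P (absz (idot u' u' + idot (e *: u' + 1 *: v') (e *: u' + 1 *: v'))).
      apply/asboolP; exists u', (e *: u' + 1 *: v'); split => //.
        by rewrite int_row_lin2 rpredD// rpredZ.
      by rewrite gram_shear.
    move=> /nmin; rewrite -n'.
    have := (idot_ge0 u', idot_ge0 v', idot_ge0 (e *: u' + 1 *: v')).
    by move=> [[]]; lia.
  (* The two shears give [0 <= |u'|^2 + 2 <u', v'>] and [0 <= |u'|^2 - 2 <u', v'>]. *)
  have := (le 1, le (- 1)).
  rewrite !idot_lin2 !(idotC _ (_ + _)) !idot_lin2 (idotC v' u') => -[].
  by lia.
have g' : gram v u = gram u0 v0 by rewrite gramC.
have n' : absz (idot v v + idot u u) = n by rewrite addrC.
have [uv|/ltW vu] := leP (idot u u) (idot v v).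
  exists u, v; split; rewrite ?guv//; split=> //; exact: shear.
exists v, u; split; rewrite ?g'//; split=> //; exact: shear.
Qed.

End RationalPlanes.

(** * Summation over the scales 2^k *)

Section MainArgument.
Context {R : realType}.
Local Notation lam := (@lebesgue_measure R).

Lemma lebesgue4_bigcup (A : (set (params R))^nat) (b : nat -> R) (c : R) :
  (forall k, measurable (A k)) -> (forall k, (lebesgue4 (A k) <= (b k)%:E)%E) ->
  (forall n, \sum_(0 <= k < n) b k <= c) ->
  (lebesgue4 (\bigcup_k A k) <= c%:E)%E.
Proof.
move=> mA Ab bc.
pose mu : {measure set _ -> \bar R} :=
  prod_measure (prod_measure (prod_measure lam lam) lam) lam.
apply: (@le_trans _ _ (\sum_(0 <= k <oo) mu (A k))%E).
  have mU : measurable (\bigcup_k A k) by exact: bigcup_measurable.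
  exact: (@measure_sigma_subadditive _ _ _ mu _ A mA mU).
apply: lime_le; first exact: is_cvg_nneseries.
apply: nearW => n; apply: le_trans (_ : ((\sum_(0 <= k < n) b k)%:E <= _)%E).
  by rewrite -sumEFin; apply: lee_sum => k _; exact: Ab.
by rewrite lee_fin.
Qed.

Lemma lebesgue4_bigU (T : eqType) (A : T -> set (params R)) (s : seq T) (b : R) :
  (forall x, x \in s -> measurable (A x)) ->
  (forall x, x \in s -> (lebesgue4 (A x) <= b%:E)%E) ->
  measurable (\big[setU/set0]_(x <- s) A x) /\
  (lebesgue4 (\big[setU/set0]_(x <- s) A x) <= ((size s)%:R * b)%:E)%E.
Proof.
elim: s => [|x s IH] mA Ab.
  by rewrite big_nil mul0r; split=> //; rewrite lebesgue4E measure0.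
have [y ys|y ys|mU Ub] := IH; [by apply: mA; rewrite inE ys orbT|
  by apply: Ab; rewrite inE ys orbT|].
have mx := mA x (mem_head x s); have bx := Ab x (mem_head x s).
rewrite big_cons; split; first exact: measurableU mx mU.
rewrite (_ : (size (x :: s))%:R * b = b + (size s)%:R * b); last first.
  by rewrite /= -natr1; ring.
exact: lebesgue4U mx mU bx Ub.
Qed.

(** The threshold is scaled by the covolume of the pair, which is the norm of the coefficient
    vector, so that the measure bound is uniform in [p]. *)
Definition meet_nbhd (i1 i2 i3 i4 : 'I_4) (s : R)
    (p : 'rV[int]_4 * 'rV[int]_4) : set (params R) :=
  let pl := plucker (int_row p.1) (int_row p.2) in
  schubert_nbhd (pl i3 i4) (- pl i1 i4) (- pl i2 i4) (pl i1 i3) (pl i2 i3)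
    (pl i1 i2) (Num.sqrt (gram p.1 p.2)%:~R * s).

Lemma lebesgue4_meet_nbhd i1 i2 i3 i4 s p : uniq [:: i1; i2; i3; i4] ->
  0 <= s -> 0 < gram p.1 p.2 ->
  (lebesgue4 (meet_nbhd i1 i2 i3 i4 s p) <= (512 * (100 * s))%:E)%E.
Proof.
move=> U s0 g0; apply: lebesgue4_schubert_nbhd => //.
  by rewrite sqrtr_gt0 ltr0z.
rewrite !sqrrN (sum_plucker_sqr U) dot_gram_int_row sqr_sqrtr//.
by rewrite ler0z ltW.
Qed.

Definition scale_pairs k : seq ('rV[int]_4 * 'rV[int]_4) :=
  [seq p <- short_pairs (3 * 2 ^ k) | 0 < gram p.1 p.2].

Lemma size_scale_pairs k :
  (size (scale_pairs k))%:R <= 200 * 300 * 81 * 16 ^+ k :> R.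
Proof.
rewrite size_filter; apply: le_trans (_ : (size (short_pairs (3 * 2 ^ k)))%:R <= _).
  by rewrite ler_nat count_size.
apply: le_trans (_ : (200 * 300 * (3 * 2 ^ k) ^ 4)%N%:R <= _).
  by rewrite ler_nat size_short_pairs.
rewrite natrM natrX natrM natrM natrX exprMn -exprM mulnC exprM.
rewrite (_ : 2%:R ^+ 4 = 16 :> R); last by ring.
by rewrite (_ : 3%:R ^+ 4 = 81 :> R) ?mulrA//; ring.
Qed.

(** A reduced pair has [|u|^2 |v|^2 <= 4 / 3 * gram u v], which is below [16 / 3 * 4 ^ k] and hence
    below [9 * 4 ^ k], the square of [3 * 2 ^ k]. *)
Lemma mem_scale_pairs u v k : 0 < gram u v ->
  idot u u <= idot v v -> 2 * `|idot u v| <= idot u u ->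
  gram u v < 4 ^+ k.+1 -> (u, v) \in scale_pairs k.
Proof.
move=> g0 uv duv gk; rewrite mem_filter /= g0 /=.
have u0 := idot_ge0 u.
apply: mem_short_pairs => //.
  rewrite lt_def u0 andbT; apply: contraTneq g0 => u00.
  by rewrite -leNgt /gram u00 mul0r; have := sqr_ge0 (idot u v); lia.
have sq : 4 * idot u v ^+ 2 <= idot u u * idot v v.
  have : (2 * `|idot u v|) ^+ 2 <= idot u u ^+ 2.
    by rewrite !expr2; apply: ler_pM => //; rewrite mulr_ge0.
  rewrite exprMn real_normK ?num_real// => h.
  by have : idot u u * idot u u <= idot u u * idot v v by [exact: ler_wpM2l]; nia.
have -> : (3 * 2 ^ k)%N%:Z ^+ 2 = 9 * 4 ^+ k.
  rewrite PoszM exprMn (_ : 3%:Z ^+ 2 = 9)// (_ : (2 ^ k)%N%:Z = 2 ^+ k).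
    by rewrite -exprM mulnC exprM.
  by rewrite -natz natrX natz.
have : 0 <= 4 ^+ k :> int by rewrite exprn_ge0.
move: gk; rewrite /gram [4 ^+ k.+1]exprS; move: (4 ^+ k) sq => q; lia.
Qed.

(** Assuming a bound on the sums over scales lets one argument serve both general functions, through
    condensation, and powers, through a geometric series. *)
Lemma ae_plane_of_scales (om : R -> R) (M : R) :
  (forall x, 1 <= x -> 0 < om x) ->
  (forall x y, 1 <= x -> x <= y -> om y <= om x) ->
  (forall n, \sum_(0 <= k < n) 16 ^+ k * om (2 ^+ k) <= M) ->
  ae_plane (fun A : {vspace 'rV[R]_4} =>
    exists2 C : R, 0 < C &
      forall B : {vspace 'rV[R]_4}, \dim B = 2%N -> rational_subspace B ->
        C * om (height B) <= psi A B).
Proof.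
move=> om0 om_le omM i1 i2 i3 i4 i12 i34 U.
have p1 k : 1 <= 2 ^+ k :> R by rewrite exprn_ege1// ler1n.
(* [n.+1%:R^-1] is the constant [C] under trial, and [3] is the factor in [schubert_le_psi]. *)
pose s n k : R := 3 * (n.+1%:R^-1 * om (2 ^+ k)).
have s0 n k : 0 <= s n k.
  by rewrite /s !mulr_ge0// ?invr_ge0 ?ler0n// ltW// om0.
pose bad n k := \big[setU/set0]_(p <- scale_pairs k) meet_nbhd i1 i2 i3 i4 (s n k) p.
have [mbad bad_le] : (forall n k, measurable (bad n k)) /\
    (forall n k, (lebesgue4 (bad n k) <=
       ((size (scale_pairs k))%:R * (512 * (100 * s n k)))%:E)%E).
  apply/all_and2 => n; apply/all_and2 => k; apply: lebesgue4_bigU => p.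
    by move=> _; exact: measurable_schubert_nbhd.
  by rewrite mem_filter => /andP[g0 _]; exact: lebesgue4_meet_nbhd.
pose K : R := 200 * 300 * 81 * (512 * (100 * 3)).
have K0 : 0 <= K by rewrite /K; lra.
have M0 : 0 <= M by have := omM 0%N; rewrite big_geq.
have mbigcup n : measurable (\bigcup_k bad n k) by exact: bigcup_measurable.
have bad_small n : (lebesgue4 (\bigcup_k bad n k) <= (K * M / n.+1%:R)%:E)%E.
  apply: (@lebesgue4_bigcup _ (fun k => K / n.+1%:R * (16 ^+ k * om (2 ^+ k)))) => //.
    move=> k; apply: le_trans (bad_le n k) _; rewrite lee_fin.
    have := @size_scale_pairs k => h.
    have b0 : 0 <= 512 * (100 * s n k).
      exact: mulr_ge0 (ler0n _ _) (mulr_ge0 (ler0n _ _) (s0 n k)).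
    apply: le_trans (ler_wpM2r b0 h) _.
    by rewrite le_eqVlt; apply/orP/or_introl/eqP; rewrite /K /s; ring.
  move=> m; rewrite -mulr_sumr (_ : K * M / _ = K / n.+1%:R * M); last by ring.
  by apply: ler_wpM2l => //; rewrite divr_ge0.
exists (\bigcap_n \bigcup_k bad n k); split.
- exact: bigcap_measurable.
- apply/eqP; rewrite eq_le; apply/andP; split; last first.
    by rewrite lebesgue4E measure_ge0.
  apply/lee_addgt0Pr => e e0; rewrite add0e.
  pose n := Num.truncn (K * M / e).
  apply: le_trans (_ : (lebesgue4 (\bigcup_k bad n k) <= _)%E).
    by apply: le_lebesgue4 => //; [exact: bigcap_measurable|exact: bigcap_inf].
  apply: le_trans (bad_small n) _; rewrite lee_fin ler_pdivrMr ?ltr0n//.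
  rewrite [leRHS]mulrC -ler_pdivrMr//; apply: ltW; exact: truncnS_gt.
(* If [l] avoids [bad n k] for all [k], then [C = n.+1%:R^-1] is admissible; hence an exceptional
   [l] lies in the union for every [n]. *)
move=> l [ldom [/= dA nP]] n _; apply: contrapT => nbad; apply: nP.
exists n.+1%:R^-1; first by rewrite invr_gt0 ltr0n.
move=> B dB rB; rewrite leNgt; apply/negP => small; apply: nbad.
have [u [v [uB vB g0 hE [uv duv]]]] := reduced_pair dB rB.
(* The Gram determinant is the squared height, so [2 ^ k <= height B < 2 ^ k.+1]. *)
pose k := trunc_log 4 (absz (gram u v)).
have g0n : (0 < absz (gram u v))%N by lia.
have kl : (4 ^ k <= absz (gram u v))%N by exact: trunc_logP.
have ku : (absz (gram u v) < 4 ^ k.+1)%N by exact: trunc_log_ltn.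
exists k => //; rewrite /bad -bigcup_seq; exists (u, v).
  apply: mem_scale_pairs => //.
  suff -> : 4 ^+ k.+1 = (4 ^ k.+1)%N%:Z :> int by lia.
  by rewrite -[RHS]natz natrX.
have h2 : 2 ^+ k <= height B.
  rewrite hE -[leLHS]ger0_norm ?exprn_ge0// -sqrtr_sqr ler_sqrt; last first.
    by rewrite ler0z ltW.
  rewrite -exprM mulnC exprM (_ : 2 ^+ 2 = 4%:R); last by ring.
  by rewrite -natrX -[(gram u v)]gtz0_abs// ler_nat.
split.
  case: l ldom {dA small} => -[[x y] z] w /= [].
  by rewrite !in_itv /= -!ler_norml.
have := @schubert_le_psi _ i1 i2 i3 i4 l B (int_row u) (int_row v) U ldom dA dB
  (plane_span dB uB vB g0).
rewrite dot_gram_int_row ltr0z => /(_ g0) h; apply: le_trans h _.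
rewrite -mulrA mulrCA; apply: ler_wpM2l; first exact: sqrtr_ge0.
rewrite /s; apply: ler_wpM2l => //; apply: le_trans (ltW small) _.
by apply: ler_wpM2l; [rewrite invr_ge0|exact: om_le].
Qed.

(** The block [4 ^ k <= j < 4 ^ k.+1] has [3 * 4 ^ k] terms, each at least [4 ^ k * om (2 ^ k.+1)]
    because the square root of [j] is at most [2 ^ k.+1]. *)
Lemma sum_scales_le (om : R -> R) n :
  (forall x, 1 <= x -> 0 < om x) ->
  (forall x y, 1 <= x -> x <= y -> om y <= om x) ->
  3 * \sum_(0 <= k < n) 16 ^+ k * om (2 ^+ k.+1)
    <= \sum_(1 <= j < 4 ^ n) j%:R * om (Num.sqrt j%:R).
Proof.
move=> om0 om_le; elim: n => [|n IH].
  by rewrite expn0 !big_geq// mulr0.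
have n4 : (1 <= 4 ^ n <= 4 ^ n.+1)%N.
  by rewrite expn_gt0/= leq_pexp2l.
have /andP[n1 n2] := n4.
rewrite big_nat_recr//= mulrDr (big_cat_nat n1 n2)/=; apply: lerD => //.
apply: le_trans (_ : \sum_(4 ^ n <= j < 4 ^ n.+1) 4 ^+ n * om (2 ^+ n.+1) <= _).
  rewrite big_const_nat iter_addr_0 -[leRHS]mulr_natl natrB// expnS natrM natrX.
  rewrite (_ : 16 = 4 * 4); last by ring.
  by rewrite exprMn le_eqVlt; apply/orP/or_introl/eqP; ring.
apply: ler_sum_nat => j /andP[nj jn].
have j1 : 1 <= j%:R :> R by rewrite ler1n; lia.
apply: ler_pM => //.
- by rewrite ltW// om0// exprn_ege1// ler1n.
- by rewrite -natrX ler_nat.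
apply: om_le; first by rewrite -[leLHS]sqrtr1 ler_sqrt ?ler0n.
rewrite -[leRHS]ger0_norm ?exprn_ge0// -sqrtr_sqr ler_sqrt ?exprn_ge0//.
rewrite -exprM mulnC exprM (_ : 2 ^+ 2 = 4%:R); last by ring.
by rewrite -natrX ler_nat ltnW.
Qed.

Lemma scales_bounded_of_series (om : R -> R) :
  (forall x, 1 <= x -> 0 < om x) ->
  (forall x y, 1 <= x -> x <= y -> om y <= om x) ->
  (\sum_(1 <= j <oo) (j%:R * om (Num.sqrt j%:R))%:E < +oo)%E ->
  exists M : R, forall n, \sum_(0 <= k < n) 16 ^+ k * om (2 ^+ k) <= M.
Proof.
move=> om0 om_le; set S := (\sum_(1 <= j <oo) _)%E => Soo.
have t0 j : (1 <= j)%N -> (0 <= (j%:R * om (Num.sqrt j%:R))%:E)%E.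
  move=> j1; rewrite lee_fin mulr_ge0// ltW// om0//.
  by rewrite -[leLHS]sqrtr1 ler_sqrt ?ler1n// ler0n.
have S0 : (0 <= S)%E by apply: nneseries_ge0 => j j1 _; exact: t0.
have SE : S = (fine S)%:E by rewrite fineK// ge0_fin_numE.
(* The term [k = 0] is split off; shifting the others by one scale costs the factor [16] and yields
   the sum in [sum_scales_le]. *)
exists (om 1 + 16 * fine S) => -[|n].
  rewrite big_geq//; apply: addr_ge0; first by rewrite ltW// om0.
  by apply: mulr_ge0 => //; exact: fine_ge0.
rewrite big_nat_recl// !expr0 mul1r; apply: lerD => //.
under eq_bigr do rewrite exprS -mulrA.
rewrite -mulr_sumr; apply: ler_wpM2l => //.
have part : \sum_(1 <= j < 4 ^ n) j%:R * om (Num.sqrt j%:R) <= fine S.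
  rewrite -lee_fin -SE -sumEFin; apply: nneseries_lim_ge => j j1 _; exact: t0.
have := le_trans (sum_scales_le n om0 om_le) part.
have : 0 <= \sum_(0 <= k < n) 16 ^+ k * om (2 ^+ k.+1).
  apply: sumr_ge0 => k _; rewrite mulr_ge0 ?exprn_ge0// ltW// om0//.
  by rewrite exprn_ege1// ler1n.
lra.
Qed.

(** The terms are the powers of [q], which equals [2] to the power [- eps], so the sums are
    geometric with ratio below [1]. *)
Lemma powR_scales_bounded (eps : R) : 0 < eps ->
  exists M : R, forall n,
    \sum_(0 <= k < n) 16 ^+ k * (2 ^+ k) `^ (- 4 - eps) <= M.
Proof.
move=> eps0; pose q : R := 16 * 2 `^ (- 4 - eps).
have q0 : 0 <= q by rewrite mulr_ge0// powR_ge0.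
have q1 : q < 1.
  have -> : q = 2 `^ (- eps).
    rewrite /q powRD; last by rewrite pnatr_eq0 implybT.
    rewrite [2 `^ (- 4)]powRN powR_mulrn// (_ : 2 ^+ 4 = 16); last by ring.
    by rewrite mulrA divff ?mul1r// pnatr_eq0.
  rewrite powRN invf_lt1 ?powR_gt0//.
  have := @gt0_ltr_powR _ _ eps0 1 2; rewrite powR1.
  by apply; rewrite ?nnegrE ?ltr1n.
have termE k : 16 ^+ k * (2 ^+ k) `^ (- 4 - eps) = q ^+ k.
  by rewrite /q exprMn -[2 ^+ k]powR_mulrn// powRAC powR_mulrn// powR_ge0.
exists (1 - q)^-1 => n; under eq_bigr do rewrite termE.
suff : \sum_(0 <= k < n) q ^+ k = (1 - q ^+ n) / (1 - q).
  move=> ->; rewrite ler_pdivrMr ?subr_gt0// mulVf; last by rewrite gt_eqF ?subr_gt0.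
  by rewrite gerBl exprn_ge0.
elim: n => [|n IH]; first by rewrite big_geq// expr0 subrr mul0r.
rewrite big_nat_recr//= IH exprS; field; lra.
Qed.

End MainArgument.

Theorem mainTheorem1 (R : realType) :
  (forall omega : R -> R,
     (forall x : R, 1 <= x -> 0 < omega x) ->
     (forall x y : R, 1 <= x -> x <= y -> omega y <= omega x) ->
     (\sum_(1 <= j <oo) (j%:R * omega (Num.sqrt j%:R))%:E < +oo)%E ->
     ae_plane (fun A : {vspace 'rV[R]_4} =>
       exists2 C : R, 0 < C &
         forall B : {vspace 'rV[R]_4}, \dim B = 2%N -> rational_subspace B ->
           C * omega (height B) <= psi A B)) /\
  (forall eps : R, 0 < eps ->
     ae_plane (fun A : {vspace 'rV[R]_4} =>
       exists2 C : R, 0 < C &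
         forall B : {vspace 'rV[R]_4}, \dim B = 2%N -> rational_subspace B ->
           C * height B `^ (- 4 - eps) <= psi A B)).
Proof.
split=> [omega om0 om_le omS|eps eps0].
  have [M omM] := scales_bounded_of_series om0 om_le omS.
  exact: ae_plane_of_scales om0 om_le omM.
have [M omM] := powR_scales_bounded eps0.
apply: (ae_plane_of_scales (om := fun x => x `^ (- 4 - eps)) _ _ omM)
  => [x x1|x y x1 xy].
  by rewrite powR_gt0// (lt_le_trans _ x1).
have -> : - 4 - eps = - (4 + eps) by ring.
rewrite !powRN lef_pV2 ?posrE ?powR_gt0; try lra.
by apply: ge0_ler_powR; rewrite ?nnegrE; lra.
Qed.
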